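(* Let $q$ be a prime power, let $s\ge1$ be an integer, let $F$ be a global function field with full constant field $\mathbb{F}_q$ and genus $g$, and let $P_\infty,P_1,\ldots,P_s$ be $s+1$ distinct places of $F$ with $\deg(P_\infty)=1$. Put $e_i=\deg(P_i)$ for $1\le i\le s$ and $\boldsymbol{e}=(e_1,\ldots,e_s)$. Then the matrices $C^{(1)},\ldots,C^{(s)}\in\mathbb{F}_q^{\mathbb{N}\times\mathbb{N}_0}$ given by the refined columnwise construction (described in the context) generate, by the digital method, a $(g,\boldsymbol{e},s)$-sequence in base $q$, and this sequence is also a $(t,s)$-sequence in base $q$ with $t=g+\sum_{i=1}^s(e_i-1)$.
   Context: **Refined columnwise construction.** Let $v=\mathrm{lcm}(e_1,\ldots,e_s)$. For a divisor $D$ of $F$ let $\mathcal{L}(D)=\{f\in F^*:\mathrm{div}(f)+D\ge 0\}\cup\{0\}$ be the Riemann-Roch space and $\ell(D)$ its dimension over $\mathbb{F}_q$. The gap numbers of $P_\infty$ are the $g$ positive integers $n$ with $\ell(nP_\infty)=\ell((n-1)P_\infty)$. Let $n_0<n_1<\cdots$ be the elements of $\mathbb{N}_0$ that are not gap numbers of $P_\infty$, in increasing order (so $n_r=r+g$ for $r\ge g$). Choose elements $y_r\in F$, $r\ge0$, as follows. - For $0\le r\le g$: any $y_r\in\mathcal{L}(n_rP_\infty)\setminus\mathcal{L}((n_r-1)P_\infty)$. - For $r>g$: determine integers $l_s,l_{s-1},\ldots,l_1\ge0$ by successive division with remainder: $w_{s+1}:=r-g$ and, for $i=s,s-1,\ldots,1$,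 $w_{i+1}=iv\,l_i+w_i$ with $w_i\in\{0,\ldots,iv-1\}$. Then choose any $y_r\in\mathcal{L}(D_r)\setminus\mathcal{L}(D_r')$, where $D_r=n_rP_\infty-\sum_{i=1}^s(l_i+l_{i+1}+\cdots+l_s)\frac{v}{e_i}P_i$ and $D_r'=n_{r-1}P_\infty-\sum_{i=1}^s(l_i+l_{i+1}+\cdots+l_s)\frac{v}{e_i}P_i$ (such a $y_r$ exists). For $1\le i\le s$ choose a local parameter $z_i$ at $P_i$ (i.e. $\nu_{P_i}(z_i)=1$) and write the local expansion of $y_r$ at $P_i$ as $y_r=\sum_{k=0}^\infty\beta^{(i)}_{k,r}z_i^k$ with $\beta^{(i)}_{k,r}\in\mathbb{F}_{q^{e_i}}$ (the residue class field of $P_i$; expansion in the completion of $F$ at $P_i$, identified with $\mathbb{F}_{q^{e_i}}((z_i))$). Using a fixed ordered basis of $\mathbb{F}_{q^{e_i}}/\mathbb{F}_q$, identify $\beta^{(i)}_{k,r}$ with a column vector $\boldsymbol{b}^{(i)}_{k,r}\in\mathbb{F}_q^{e_i}$. Column $r$ of $C^{(i)}=(c^{(i)}_{j,r})_{j\ge1,r\ge0}$ is the concatenation of $\boldsymbol{b}^{(i)}_{0,r},\boldsymbol{b}^{(i)}_{1,r},\ldots$; i.e. $c^{(i)}_{ke_i+h,r}$ is the $h$th coordinate of $\boldsymbol{b}^{(i)}_{k,r}$ for $k\ge0$, $1\le h\le e_i$. **Digital method.** Let $Z_q=\{0,1,\ldots,q-1\}\subset\mathbb{Z}$. Choose bijections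 $\psi_r:Z_q\to\mathbb{F}_q$ ($r\ge0$) with $\psi_r(0)=0$ for all sufficiently large $r$, and bijections $\lambda_{i,j}:\mathbb{F}_q\to Z_q$ ($1\le i\le s$, $j\ge1$); these choices are arbitrary. For $n\ge0$ with base-$q$ expansion $n=\sum_{r\ge0}z_r(n)q^r$, put $y^{(i)}_{n,j}=\sum_{r\ge0}c^{(i)}_{j,r}\psi_r(z_r(n))\in\mathbb{F}_q$ and $x^{(i)}_n=\sum_{j\ge1}\lambda_{i,j}(y^{(i)}_{n,j})q^{-j}$. The sequence generated by $C^{(1)},\ldots,C^{(s)}$ is $\boldsymbol{x}_n=(x_n^{(1)},\ldots,x_n^{(s)})$, $n\ge0$. **Nets and sequences.** Point sets are counted with multiplicity: for a point set $\mathcal{P}$ (finite indexed family), $A(J;\mathcal{P})$ is the number of indices $n$ with $\boldsymbol{x}_n\in J$. Let $b\ge2$, $s\ge1$, $0\le u\le m$ be integers, $\boldsymbol{e}=(e_1,\ldots,e_s)\in\mathbb{N}^s$. A *$(u,m,\boldsymbol{e},s)$-net in base $b$* is a point set $\mathcal{P}$ of $b^m$ points in $[0,1)^s$ such that $A(J;\mathcal{P})=b^m\,\mathrm{Vol}(J)$ for every interval $J=\prod_{i=1}^s[a_ib^{-d_i},(a_i+1)b^{-d_i})$ with integers $d_i\ge0$, $0\le a_i<b^{d_i}$, $e_i\mid d_i$ for $1\le i\le s$, and $\mathrm{Vol}(J)\ge b^{u-m}$. For $u\ge0$, a sequence $\boldsymbol{x}_0,\boldsymbol{x}_1,\ldots$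 in $[0,1]^s$ is a *$(u,\boldsymbol{e},s)$-sequence in base $b$* if for all integers $k\ge0$ and $m>u$ the points $[\boldsymbol{x}_n]_{b,m}$, $kb^m\le n<(k+1)b^m$, form a $(u,m,\boldsymbol{e},s)$-net in base $b$. Here $[\boldsymbol{x}_n]_{b,m}$ is the coordinatewise $m$-digit truncation in base $b$, taken with respect to the given digit expansion of each coordinate (for the digital method: $\sum_{j\ge1}\lambda_{i,j}(y^{(i)}_{n,j})q^{-j}$ is truncated to $\sum_{j=1}^m$). For $0\le t\le m$, a *$(t,m,s)$-net in base $b$* is a point set of $b^m$ points in $[0,1)^s$ such that every interval $\prod_{i=1}^s[a_ib^{-d_i},(a_i+1)b^{-d_i})$ with integers $d_i\ge0$, $0\le a_i<b^{d_i}$ and volume $b^{t-m}$ contains exactly $b^t$ of the points; a *$(t,s)$-sequence in base $b$* is a sequence such that for all $k\ge0$, $m>t$ the points $[\boldsymbol{x}_n]_{b,m}$, $kb^m\le n<(k+1)b^m$, form a $(t,m,s)$-net in base $b$. *)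

(* Defs.v *)
From HB Require Import structures.
From mathcomp Require Import all_boot all_order all_algebra all_field.
From mathcomp Require Import all_classical all_reals all_analysis.

Set Implicit Arguments.
Unset Strict Implicit.
Unset Printing Implicit Defensive.

Import Order.TTheory GRing.Theory Num.Theory.
Import numFieldNormedType.Exports.

Local Open Scope classical_set_scope.
Local Open Scope ring_scope.

(** * Discrete valuations *)

(* The value at 0, which is mathematically +oo, is set to the dummy value 0;
   [vge] below restores the correct meaning of "valuation at least n" at 0.
   Fixing this value makes a valuation determined by its restriction to the
   nonzero elements. *)
Definition normalized_valuation (E : fieldType) (v : E -> int) : Prop :=
  [/\ v 0 = 0,
      forall x y, x != 0 -> y != 0 -> v (x * y) = v x + v y,
      forall x y, x != 0 -> y != 0 -> x + y != 0 ->
        Num.min (v x) (v y) <= v (x + y)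
    & exists x, v x = 1].

Definition vge (E : fieldType) (v : E -> int) (n : int) (x : E) : bool :=
  (x == 0) || (n <= v x).

Definition vcvg (E : fieldType) (v : E -> int) (u : nat -> E) (l : E) : Prop :=
  forall n : int, exists M : nat,
    forall m : nat, (M <= m)%N -> vge v n (u m - l).

Definition vcauchy (E : fieldType) (v : E -> int) (u : nat -> E) : Prop :=
  forall n : int, exists M : nat,
    forall m1 m2 : nat, (M <= m1)%N -> (M <= m2)%N -> vge v n (u m1 - u m2).

(** * Function fields

   A global function field with constants [k] is a finite extension [F] of the
   rational function field k(x) = {fraction {poly k}}. *)

Section FunctionField.
Variables (k : finFieldType) (F : fieldExtType {fraction {poly k}}).

Definition constF (c : k) : F := (tofrac c%:P)%:A.

Definition full_constant_field : Prop :=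
  forall f : F, algebraicOver constF f -> exists c : k, f = constF c.

(* Places are represented by their normalized valuations; triviality on the
   constants is automatic because [k] is finite. *)
Record place := Place {
  val_of :> F -> int;
  val_ofP : normalized_valuation val_of }.

HB.instance Definition _ := gen_eqMixin place.
HB.instance Definition _ := gen_choiceMixin place.

(* [quot_dim V W n]: for k-subspaces W <= V of F, dim_k (V / W) = n. *)
Definition quot_dim (V W : set F) (n : nat) : Prop :=
  exists b : 'I_n -> F, (forall j, V (b j)) /\
    forall f, V f ->
      exists! c : 'rV[k]_n, W (f - \sum_(j < n) constF (c 0 j) * b j).

(* Junk value 0 if V / W is not finite-dimensional. *)
Definition dimk (V W : set F) : nat := xget 0%N [set n | quot_dim V W n].

Definition place_deg (P : place) : nat :=
  dimk [set f | vge P 0 f] [set f | vge P 1 f].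

(** Divisors: functions from places to int with finite support, with the
   pointwise group structure. *)

Definition is_divisor (D : place -> int) : Prop :=
  finite_set [set P | D P != 0].

Definition prime_div (P : place) : place -> int := fun Q => (Q == P)%:Z.

Definition div_deg (D : place -> int) : int :=
  \sum_(P \in [set: place]) D P * (place_deg P)%:Z.

(* The principal divisor of [f]; meaningful for f != 0. *)
Definition princ_div (f : F) : place -> int := fun P => P f.

Definition RRspace (D : place -> int) : set F :=
  [set f | f != 0 /\ forall P, 0 <= (princ_div f + D) P] `|` [set 0].

Definition ell (D : place -> int) : nat := dimk (RRspace D) [set 0].

Definition is_genus (g : nat) : Prop :=
  (forall D, is_divisor D -> div_deg D + 1 - (ell D)%:Z <= g%:Z) /\
  (exists D, is_divisor D /\ div_deg D + 1 - (ell D)%:Z = g%:Z).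

Definition gap_number (P : place) (n : nat) : Prop :=
  (0 < n)%N /\ ell (prime_div P *~ n%:Z) = ell (prime_div P *~ (n%:Z - 1)).

Definition nongap_enum (P : place) (n : nat -> nat) : Prop :=
  {homo n : r r' / (r < r')%N} /\
  forall m : nat, ~ gap_number P m <-> exists r, n r = m.

(** ** Completions and local expansions *)

Record completion (P : place) := Completion {
  cfield : fieldType;
  cval : cfield -> int;
  cemb : {rmorphism F -> cfield};
  cvalP : normalized_valuation cval;
  cval_emb : forall f : F, cval (cemb f) = P f;
  cemb_dense : forall (u : cfield) (n : int),
    exists f : F, vge cval n (u - cemb f);
  cfield_complete : forall u : nat -> cfield,
    vcauchy cval u -> exists l, vcvg cval u l }.

(* The residue class field, realized as a subfield of the completion over [k]:
   [rlift] is a section of the reduction map from the completed valuation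
   ring.  This is the inclusion of coefficients that identifies the completion
   with the field of formal Laurent series over the residue class field. *)
Record residue_field (P : place) (Fh : completion P) := ResidueField {
  rfield : fieldExtType k;
  rlift : {rmorphism rfield -> cfield Fh};
  rlift_const : forall c : k, rlift c%:A = cemb Fh (constF c);
  rlift_residue : forall u : cfield Fh, vge (@cval _ Fh) 0 u ->
    exists! a : rfield, vge (@cval _ Fh) 1 (u - rlift a) }.

Definition local_expansion (P : place) (Fh : completion P)
    (K : residue_field Fh) (z y : F) (beta : nat -> rfield K) : Prop :=
  vcvg (@cval _ Fh)
    (fun N => \sum_(h < N) rlift K (beta h) * cemb Fh z ^+ h) (cemb Fh y).

(** ** The refined columnwise construction

   The places P_1, ..., P_s are indexed from 0: [P i] is P_(i+1). *)

Definition successive_division (s v n : nat) (l w : nat -> nat) : Prop :=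
  w s.+1 = n /\
  forall i, (1 <= i <= s)%N ->
    w i.+1 = (i * v * l i + w i)%N /\ (w i < i * v)%N.

Definition lcm_deg (s : nat) (P : 'I_s -> place) : nat :=
  \big[lcmn/1%N]_(i < s) place_deg (P i).

(* The divisor a P_oo - sum_i (l_i + ... + l_s) (v / e_i) P_i. *)
Definition column_div (s : nat) (Poo : place) (P : 'I_s -> place)
    (l : nat -> nat) (a : int) : place -> int :=
  prime_div Poo *~ a
  - \sum_(i < s) prime_div (P i) *+
      ((\sum_(i.+1 <= h < s.+1) l h) * (lcm_deg P %/ place_deg (P i)))%N.

Definition refined_columns (g s : nat) (Poo : place) (P : 'I_s -> place)
    (n : nat -> nat) (y : nat -> F) : Prop :=
  (forall r, (r <= g)%N ->
     RRspace (prime_div Poo *~ (n r)%:Z) (y r) /\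
     ~ RRspace (prime_div Poo *~ ((n r)%:Z - 1)) (y r)) /\
  (forall r, (g < r)%N -> exists l w : nat -> nat,
     [/\ successive_division s (lcm_deg P) (r - g) l w,
         RRspace (column_div Poo P l (n r)%:Z) (y r)
       & ~ RRspace (column_div Poo P l (n r.-1)%:Z) (y r)]).

(* [C i j r] is the entry in row j >= 1 and column r >= 0; the value at j = 0
   is irrelevant.  The coordinates of the basis are numbered from 0. *)
Definition generating_matrices (s : nat) (P : 'I_s -> place)
    (Fh : forall i, completion (P i)) (K : forall i, residue_field (Fh i))
    (B : forall i, (place_deg (P i)).-tuple (rfield (K i)))
    (beta : forall i, nat -> nat -> rfield (K i))
    (C : 'I_s -> nat -> nat -> k) : Prop :=
  forall (i : 'I_s) (r h : nat) (t : 'I_(place_deg (P i))),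
    C i (h * place_deg (P i) + t.+1)%N r = coord (B i) t (beta i h r).

End FunctionField.

(** * The digital method *)

Section DigitalMethod.
Variable k : finFieldType.

Definition digit0 : 'I_#|k| := Ordinal (ltnW (finNzRing_gt1 k)).

Definition base_digit (n r : nat) : 'I_#|k| :=
  Ordinal (ltn_pmod (n %/ #|k| ^ r) (ltnW (finNzRing_gt1 k))).

(* The sum over r is finite in effect when psi r digit0 = 0 for large r. *)
Definition digital_y (s : nat) (C : 'I_s -> nat -> nat -> k)
    (psi : nat -> 'I_#|k| -> k) (n : nat) (i : 'I_s) (j : nat) : k :=
  \sum_(r \in [set: nat]) C i j r * psi r (base_digit n r).

Definition digital_digits (s : nat) (C : 'I_s -> nat -> nat -> k)
    (psi : nat -> 'I_#|k| -> k) (lam : 'I_s -> nat -> k -> 'I_#|k|)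
    (n : nat) (i : 'I_s) (j : nat) : 'I_#|k| :=
  lam i j (digital_y C psi n i j).

End DigitalMethod.

(** * Nets and sequences *)

Section Nets.
Variable R : realType.

Definition digit_sum (b : nat) (a : nat -> 'I_b) (m : nat) : R :=
  \sum_(1 <= j < m.+1) (a j)%:R / b%:R ^+ j.

Definition digit_value (b : nat) (a : nat -> 'I_b) : R :=
  limn (digit_sum a).

Definition elem_interval (b s : nat) (d a : 'I_s -> nat) : set ('I_s -> R) :=
  [set x | forall i,
     (a i)%:R / b%:R ^+ d i <= x i < (a i).+1%:R / b%:R ^+ d i].

Definition elem_vol (b s : nat) (d : 'I_s -> nat) : R :=
  \prod_(i < s) (b%:R ^+ d i)^-1.

Definition count_in (I : finType) (T : Type) (J : set T) (p : I -> T) : nat :=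
  #|[set n : I | `[< J (p n) >]]%SET|.

Definition in_unit_cube (I : finType) (s : nat) (p : I -> 'I_s -> R) : Prop :=
  forall n i, 0 <= p n i < 1.

Definition ue_net (b u m s : nat) (e : 'I_s -> nat)
    (p : 'I_(b ^ m) -> 'I_s -> R) : Prop :=
  in_unit_cube p /\
  forall d a : 'I_s -> nat,
    (forall i, (a i < b ^ d i)%N) -> (forall i, e i %| d i)%N ->
    b%:R ^ (u%:Z - m%:Z) <= elem_vol b d ->
    (count_in (elem_interval b d a) p)%:R = b%:R ^+ m * elem_vol b d.

Definition t_net (b t m s : nat) (p : 'I_(b ^ m) -> 'I_s -> R) : Prop :=
  in_unit_cube p /\
  forall d a : 'I_s -> nat,
    (forall i, (a i < b ^ d i)%N) ->
    elem_vol b d = b%:R ^ (t%:Z - m%:Z) ->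
    count_in (elem_interval b d a) p = (b ^ t)%N.

(* The points [x_n]_{b,m} for h b^m <= n < (h+1) b^m. *)
Definition truncated_block (b s : nat) (a : nat -> 'I_s -> nat -> 'I_b)
    (h m : nat) (n : 'I_(b ^ m)) (i : 'I_s) : R :=
  digit_sum (a (h * b ^ m + n)%N i) m.

(* A sequence comes with digit expansions of all coordinates, with respect to
   which the truncations are taken. *)
Definition has_expansions (b s : nat) (x : nat -> 'I_s -> R)
    (a : nat -> 'I_s -> nat -> 'I_b) : Prop :=
  forall n i, 0 <= x n i <= 1 /\ (digit_sum (a n i) @ \oo --> x n i).

Definition ue_sequence (b u s : nat) (e : 'I_s -> nat) (x : nat -> 'I_s -> R)
    (a : nat -> 'I_s -> nat -> 'I_b) : Prop :=
  has_expansions x a /\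
  forall h m : nat, (u < m)%N -> ue_net u e (@truncated_block b s a h m).

Definition t_sequence (b t s : nat) (x : nat -> 'I_s -> R)
    (a : nat -> 'I_s -> nat -> 'I_b) : Prop :=
  has_expansions x a /\
  forall h m : nat, (t < m)%N -> t_net t (@truncated_block b s a h m).

End Nets.

(* Main.v *)
Require Import Defs.
From HB Require Import structures.
From mathcomp Require Import all_boot all_order all_algebra all_field.
From mathcomp Require Import all_classical all_reals all_analysis.
From mathcomp Require Import zify ring.

Set Implicit Arguments.
Unset Strict Implicit.
Unset Printing Implicit Defensive.

Import Order.TTheory GRing.Theory Num.Theory.
Import numFieldNormedType.Exports.
Local Open Scope ring_scope.

(** Each y_r lies in the ring R of functions regular off P_oo and has pole order
   exactly n_r there; the extra zeros prescribed by the refined construction are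
   irrelevant for the two parameters.  Fix multiplicities d_i, put
   a = sum_i d_i e_i, let m >= g + a, and let I be the ideal of those f in R that
   vanish to order d_i at every P_i.  It suffices that span(y_0, ..., y_(m-1))
   maps onto prod_i O_i / P_i^(d_i), which follows from two facts.

   - R maps onto prod_i O_i / P_i^(d_i).  By Riemann's inequality for the
     divisors j P_i, for large j every leading coefficient at P_i occurs among
     the functions whose only pole is P_i, of order j.  Multiplying by a high
     power of some w in R vanishing at all P_i moves the pole to P_oo and
     creates a zero of any chosen order at P_i.

   - Every f in R has the same image as a function of pole order at most
     n_(m-1).  As deg P_oo = 1, this holds once I contains a function of
     every pole order N > n_(m-1) occurring in R.  If N were missing in I, then
     so would be N - n_0, ..., N - n_(m-1) and 0, because I is an ideal; but
     Riemann's inequality for M P_oo - sum_i d_i P_i leaves at most g + a <= m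
     natural numbers missing.

   This uses Riemann's inequality only: neither the Riemann-Roch theorem nor the
   product formula is needed. *)

(** * Arithmetic of discrete valuations *)

Section Valuation.
Variables (E : fieldType) (v : E -> int).
Hypothesis vP : normalized_valuation v.

Lemma valM (x y : E) : x != 0 -> y != 0 -> v (x * y) = v x + v y.
Proof. by case: vP => _ h _ _; apply: h. Qed.

Lemma val1 : v 1 = 0.
Proof. have := valM (oner_neq0 E) (oner_neq0 E).
by rewrite mulr1 -[LHS]addr0 => /addrI <-. Qed.

Lemma valN x : v (- x) = v x.
Proof.
have [->|x0] := eqVneq x 0; first by rewrite oppr0.
have n1 : (-1 : E) != 0 by rewrite oppr_eq0 oner_neq0.
have vn1 : v (-1) = 0.
  have /eqP := valM n1 n1.
  by rewrite mulrNN mulr1 val1 eq_sym -mulr2n mulrn_eq0 => /eqP.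
by rewrite -mulN1r valM // vn1 add0r.
Qed.

Lemma valX x n : x != 0 -> v (x ^+ n) = v x *+ n.
Proof.
move=> x0; elim: n => [|n IHn]; first by rewrite val1.
by rewrite exprS valM ?expf_neq0 // IHn mulrS.
Qed.

Lemma valV x : x != 0 -> v x^-1 = - v x.
Proof.
move=> x0; have := valM x0 (invr_neq0 x0).
by rewrite divff // val1; lia.
Qed.

Lemma vge0 n : vge v n 0.
Proof. by rewrite /vge eqxx. Qed.

Lemma vgeE n x : x != 0 -> vge v n x = (n <= v x).
Proof. by rewrite /vge => /negPf ->. Qed.

Lemma vge_le (m n : int) x : n <= m -> vge v m x -> vge v n x.
Proof. by rewrite /vge => nm /orP[->//|h]; rewrite /vge (le_trans nm h) orbT. Qed.

Lemma vgeN n x : vge v n (- x) = vge v n x.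
Proof. by rewrite /vge oppr_eq0 valN. Qed.

Lemma vgeD n x y : vge v n x -> vge v n y -> vge v n (x + y).
Proof.
have [->|x0] := eqVneq x 0; first by rewrite add0r.
have [->|y0] := eqVneq y 0; first by rewrite addr0.
have [->|xy0] := eqVneq (x + y) 0; first by rewrite vge0.
rewrite !vgeE // => hx hy; case: vP => _ _ h _.
by apply: le_trans (h _ _ x0 y0 xy0); rewrite le_min hx.
Qed.

Lemma vgeB n x y : vge v n x -> vge v n y -> vge v n (x - y).
Proof. by move=> hx hy; rewrite vgeD // vgeN. Qed.

Lemma vge_sum (I : Type) (r : seq I) (Q : pred I) (f : I -> E) n :
  (forall i, Q i -> vge v n (f i)) -> vge v n (\sum_(i <- r | Q i) f i).
Proof.
move=> h; elim/big_ind: _ => //; [exact: vge0 | by move=> *; apply: vgeD].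
Qed.

Lemma vgeM m n (x y : E) : vge v m x -> vge v n y -> vge v (m + n) (x * y).
Proof.
have [->|x0] := eqVneq x 0; first by rewrite mul0r !vge0.
have [->|y0] := eqVneq y 0; first by rewrite mulr0 !vge0.
by rewrite !vgeE ?mulf_neq0 // valM //; exact: lerD.
Qed.

Lemma vgeMl n x y : x != 0 -> vge v (v x + n) (x * y) = vge v n y.
Proof.
move=> x0; have [->|y0] := eqVneq y 0; first by rewrite mulr0 !vge0.
by rewrite !vgeE ?mulf_neq0 // valM // lerD2l.
Qed.

Lemma vge_val x : vge v (v x) x.
Proof. by rewrite /vge lexx orbT. Qed.

Lemma vgeX n x : vge v n x -> forall l : nat, vge v (n *+ l) (x ^+ l).
Proof.
move=> h; elim=> [|l IH]; first by rewrite expr0 mulr0n -val1 vge_val.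
by rewrite exprS mulrS vgeM.
Qed.

Lemma vge_trans n x y z : vge v n (x - y) -> vge v n (y - z) -> vge v n (x - z).
Proof. by move=> a b; rewrite -(subrKA y) vgeD. Qed.

Lemma vge_distC n x y : vge v n (x - y) = vge v n (y - x).
Proof. by rewrite -vgeN opprB. Qed.

Lemma val_eq_vge n x : vge v n x -> ~~ vge v (n + 1) x -> v x = n.
Proof. by rewrite /vge; case: eqP => //= _; lia. Qed.

(* The coefficients are arbitrary zero-or-unit elements, so that the lemma covers
   both constants of F and lifted residue classes. *)
Lemma expansion_coef_eq0 z (u : nat -> E) N :
  z != 0 -> 0 < v z -> (forall h, u h = 0 \/ v (u h) = 0) ->
  vge v (v z *+ N) (\sum_(h < N) u h * z ^+ h) ->
  forall h, (h < N)%N -> u h = 0.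
Proof.
move=> z0 vz; elim: N u => [|N IHN] u hu //.
rewrite big_ord_recl /= expr0 mulr1.
under eq_bigr => i _ do rewrite /bump /= add1n exprS mulrCA.
rewrite -mulr_sumr => hs.
have hu' h : vge v 0 (u h) by case: (hu h) => [->|h0]; rewrite ?vge0 // -h0 vge_val.
have u0 : u 0%N = 0.
  case: (hu 0%N) => // vu0; apply/eqP/negPn/negP => un0.
  have : vge v (v z) (u 0%N).
    rewrite -[u 0%N](addrK (z * \sum_(i < N) u i.+1 * z ^+ i)) vgeB //.
      by apply: vge_le hs; rewrite mulrS lerDl mulrn_wge0 // ltW.
    rewrite -[X in vge v X]addr0 vgeMl // vge_sum // => i _.
    rewrite -[0]add0r vgeM // -(mul0rn _ i); apply: vgeX.
    by apply: vge_le (vge_val z); exact: ltW.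
  by rewrite vgeE // vu0 => h; move: (lt_le_trans vz h); rewrite ltxx.
move: hs; rewrite u0 add0r mulrS vgeMl // => hs [|h] // hN.
by apply: (IHN (fun h => u h.+1)).
Qed.

End Valuation.

(** * Values of constants *)

Section Constants.
Variables (k : finFieldType) (F : fieldExtType {fraction {poly k}}).

Definition const_rmorph : {rmorphism k -> F} := (in_alg F \o @tofrac _ \o polyC)%FUN.

Lemma constFE c : constF F c = const_rmorph c.
Proof. by []. Qed.

(** A nonzero constant satisfies [c ^+ #|k|.-1 = 1], and a root of unity has value 0 because [int]
    is torsion-free. *)
Lemma val_const (P : place F) c : c != 0 -> P (constF F c) = 0.
Proof.
move=> c0; have := valX (val_ofP P) #|k|.-1 (_ : constF F c != 0).
rewrite constFE fmorph_eq0 c0 => /(_ isT).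
have : c ^+ #|k|.-1 = 1.
  apply: (mulfI c0); rewrite -exprS prednK ?expf_card ?mulr1 //.
  by apply: ltnW; exact: finNzRing_gt1.
move=> h; rewrite -rmorphXn h rmorph1 (val1 (val_ofP P)) => /esym /eqP.
rewrite mulrn_eq0 => /orP[|/eqP //].
by have := finNzRing_gt1 k; case: #|k| => [|[]].
Qed.

Lemma vge_const (P : place F) c : vge P 0 (constF F c).
Proof.
have [->|c0] := eqVneq c 0; first by rewrite constFE rmorph0 vge0.
by rewrite -(val_const P c0) vge_val.
Qed.

Lemma vgeZ (P : place F) n c x : vge P n x -> vge P n (constF F c * x).
Proof. by move=> h; rewrite -[n]add0r vgeM ?vge_const //; apply: val_ofP. Qed.

End Constants.

(** * Dimensions over the constants, compared by counting *)

Section Dimension.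
Variables (k : finFieldType) (F : fieldExtType {fraction {poly k}}).
Implicit Types (V W : set F) (D : place F -> int).

Definition ksubspace V :=
  V 0 /\ forall c x y, V x -> V y -> V (constF F c * x + y).

Lemma ksubspaceD V x y : ksubspace V -> V x -> V y -> V (x + y).
Proof. by move=> [_ h] Vx Vy; have := h 1 _ _ Vx Vy; rewrite constFE rmorph1 mul1r. Qed.

Lemma ksubspaceZ V c x : ksubspace V -> V x -> V (constF F c * x).
Proof. by move=> [V0 h] Vx; have := h c _ _ Vx V0; rewrite addr0. Qed.

Lemma ksubspaceB V x y : ksubspace V -> V x -> V y -> V (x - y).
Proof.
move=> [_ h] Vx Vy; have := h (-1) _ _ Vy Vx.
by rewrite constFE rmorphN1 mulN1r addrC.
Qed.

Lemma ksubspace_sum V (I : finType) (b : I -> F) (c : I -> k) :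
  ksubspace V -> (forall i, V (b i)) -> V (\sum_i constF F (c i) * b i).
Proof.
move=> sV Vb; elim/big_ind: _ => [|x y|i _]; first by case: sV.
  exact: ksubspaceD.
exact: ksubspaceZ.
Qed.

Definition spanned V (I : finType) (b : I -> F) :=
  forall f, V f -> exists c : {ffun I -> k}, f = \sum_i constF F (c i) * b i.

(** Independence is phrased as injectivity of the coordinate map, the form that the counting
    arguments below use. *)
Lemma quot_dim0P V l : quot_dim V [set 0] l ->
  exists b : 'I_l -> F, [/\ forall j, V (b j), spanned V b
    & forall c d : {ffun 'I_l -> k}, V (\sum_i constF F (c i) * b i) ->
       \sum_i constF F (c i) * b i = \sum_i constF F (d i) * b i -> c = d].
Proof.
case=> b [Vb hb]; exists b; split=> // [f /hb[c [/eqP fc _]]|c d Vc cd].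
  exists [ffun i => c 0 i]; move: fc; rewrite subr_eq0 => /eqP ->.
  by apply: eq_bigr => i _; rewrite ffunE.
have [r [_ ru]] := hb _ Vc.
have E (u : {ffun 'I_l -> k}) : \sum_j constF F ((\row_j u j) 0 j) * b j =
    \sum_i constF F (u i) * b i by apply: eq_bigr => i _; rewrite mxE.
have rc : r = \row_j c j by apply: ru; rewrite E /= subrr.
have rd : r = \row_j d j by apply: ru; rewrite E /= cd subrr.
by apply/ffunP => j; move: (congr1 (fun u : 'rV[k]_l => u 0 j) rc); rewrite rd !mxE.
Qed.

(** Rewriting combinations of a basis through [b] injects the [k]-valued families on ['I_l] into
    those on [I]; as [k] is finite, cardinals can be compared. *)
Lemma quot_dim_le_spanned V l (I : finType) (b : I -> F) :
  ksubspace V -> quot_dim V [set 0] l -> spanned V b -> (l <= #|I|)%N.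
Proof.
move=> sV /quot_dim0P[b' [Vb' _ inj_b']] sb.
have VS c : V (\sum_i constF F (c i) * b' i) by apply: ksubspace_sum.
have [h hP] := choice (fun c : {ffun 'I_l -> k} => sb _ (VS c)).
have injh : injective h.
  by move=> c d hcd; apply: inj_b' => //; rewrite !hP hcd.
have := leq_card h injh; rewrite !card_ffun card_ord leq_exp2l //.
exact: finNzRing_gt1.
Qed.

Lemma quot_dim_gt0 V l : ksubspace V -> quot_dim V [set 0] l -> (0 < l)%N ->
  exists2 f, V f & f != 0.
Proof.
move=> sV ql l0; apply: contrapT => V0.
have := @quot_dim_le_spanned V l 'I_0 (fun=> 0) sV ql; rewrite card_ord leqNgt l0.
move=> h; suff: false by []; apply: h => f Vf; exists 0.
rewrite big_ord0; apply/eqP/negPn/negP => f0; apply: V0; by exists f.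
Qed.

Lemma quot_dim_unique V l l' : ksubspace V ->
  quot_dim V [set 0] l -> quot_dim V [set 0] l' -> l = l'.
Proof.
move=> sV hl hl'; apply/eqP; rewrite eqn_leq.
have [b [_ sb _]] := quot_dim0P hl; have [b' [_ sb' _]] := quot_dim0P hl'.
have := quot_dim_le_spanned sV hl sb'; have := quot_dim_le_spanned sV hl' sb.
by rewrite !card_ord => -> ->.
Qed.

(** Rewriting elements of W in a basis of V is an injection between finite sets of equal size, hence
    onto. *)
Lemma quot_dim_subset_eq V W l : ksubspace V -> ksubspace W ->
  quot_dim W [set 0] l -> quot_dim V [set 0] l ->
  (W `<=` V)%classic -> (V `<=` W)%classic.
Proof.
move=> sV sW /quot_dim0P[b [Wb sb inj_b]] /quot_dim0P[b' [Vb' sb' inj_b']] WV f Vf.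
have WS c : W (\sum_i constF F (c i) * b i) by apply: ksubspace_sum.
have [h hP] := choice (fun c : {ffun 'I_l -> k} => sb' _ (WV _ (WS c))).
have injh : injective h.
  by move=> c d hcd; apply: inj_b => //; rewrite !hP hcd.
have [c fc] := sb' _ Vf.
have [h' _ h'K] := injF_bij injh.
by rewrite fc -[c]h'K -hP.
Qed.

(** Among the vector spaces contained in U, one of maximal dimension is all of U, since any further
    vector of U would enlarge it. *)
Lemma subspace_vspace (K : fieldType) (vT : vectType K) (U : vT -> Prop) :
  U 0 -> (forall a x y, U x -> U y -> U (a *: x + y)) ->
  exists W : {vspace vT}, forall x, U x <-> x \in W.
Proof.
move=> U0 UD.
pose Q := [pred d | `[< exists2 W : {vspace vT}, \dim W = d & forall x, x \in W -> U x >]].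
have ex : exists d, Q d.
  exists 0%N; apply/asboolP; exists 0%VS; first exact: dimv0.
  by move=> x; rewrite memv0 => /eqP ->.
have ub d : Q d -> (d <= \dim {:vT})%N.
  by move=> /asboolP[W <- _]; apply: dimvS; exact: subvf.
case: (ex_maxnP ex ub) => d /asboolP[W dW WU] dmax; exists W => x.
split=> [Ux|]; last exact: WU.
apply/negPn/negP => xW.
have : (\dim (W + <[x]>) <= d)%N.
  apply: dmax; apply/asboolP; exists (W + <[x]>)%VS => // u.
  move=> /memv_addP[w wW [_ /vlineP[c ->] ->]].
  by rewrite addrC; apply: UD => //; apply: WU.
rewrite -dW leqNgt => /negP; apply.
rewrite ltn_neqAle dimvS ?addvSl // andbT; apply: contraNneq xW => e.
have /eqP -> : (W == W + <[x]>)%VS by rewrite -dimv_leqif_eq ?addvSl // e.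
by apply: (subvP (addvSr _ _)); exact: memv_line.
Qed.

(** Coordinates in a basis of V identify W with a subspace of a row space, whose basis is carried
    back by [L]. *)
Lemma quot_dim_sub V W l : ksubspace W -> quot_dim V [set 0] l ->
  (W `<=` V)%classic -> exists l', quot_dim W [set 0] l'.
Proof.
move=> sW [b [Vb hb]] WV.
pose L (c : 'rV[k]_l) := \sum_j constF F (c 0 j) * b j.
have LD a c d : L (a *: c + d) = constF F a * L c + L d.
  rewrite /L mulr_sumr -big_split /=; apply: eq_bigr => j _.
  by rewrite !mxE !constFE rmorphD rmorphM mulrDl mulrA.
have L0 : L 0 = 0 by rewrite /L big1 // => j _; rewrite mxE constFE rmorph0 mul0r.
have Linj c d : W (L c) -> L c = L d -> c = d.
  move=> /WV/hb[r [_ ru]] cd.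
  by rewrite -(ru c) /= -?/(L c) ?subrr // -(ru d) //= -/(L d) cd subrr.
have [U UP] : exists U : {vspace 'rV[k]_l}, forall c, W (L c) <-> c \in U.
  apply: subspace_vspace; first by rewrite L0; case: sW.
  by move=> a x y; rewrite LD; case: sW => _; apply.
pose B := vbasis U; have BU : basis_of U B by exact: vbasisP.
have LS (n : nat) (c : 'I_n -> k) (X : n.-tuple 'rV[k]_l) :
    L (\sum_i c i *: X`_i) = \sum_i constF F (c i) * L X`_i.
  elim: n c X => [|n IH] c X; first by rewrite !big_ord0 L0.
  case/tupleP: X => x X; rewrite !big_ord_recl LD IH; congr (_ + _).
exists (\dim U), (fun j => L B`_j); split.
  by move=> j; apply/UP/vbasis_mem/mem_nth; rewrite size_tuple.
move=> f Wf; have [c [/eqP]] := hb _ (WV _ Wf); rewrite subr_eq0 => /eqP fc _.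
have cU : c \in U by apply/UP; rewrite /L -fc.
exists (\row_j coord B j c); split.
  rewrite /= fc -/(L c) [in L c](coord_basis BU cU) LS.
  apply/eqP; rewrite subr_eq0; apply/eqP/eq_bigr => j _; by rewrite mxE.
move=> d /eqP; rewrite subr_eq0 fc -/(L c) -LS => /eqP cd.
have := Linj _ _ _ cd; rewrite /L -fc => /(_ Wf) ->.
apply/rowP => j; rewrite mxE.
by rewrite coord_sum_free //; exact: basis_free BU.
Qed.

Lemma RRspaceP D f : RRspace D f <-> forall Q : place F, vge Q (- D Q) f.
Proof.
split=> [[[f0 h] Q|-> Q]|h]; last 2 first.
- exact: vge0.
- have [->|f0] := eqVneq f 0; [by right | left; split => // Q].
  by have := h Q; rewrite vgeE // -subr_ge0 opprK.
by rewrite vgeE // -subr_ge0 opprK; apply: h.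
Qed.

Lemma RRspace_ksubspace D : ksubspace (RRspace D).
Proof.
split=> [|c x y]; rewrite !RRspaceP; first by move=> Q; exact: vge0.
by move=> hx hy Q; apply: vgeD (vgeZ _ _) _ => //; exact: val_ofP.
Qed.

Lemma ellE D l : quot_dim (RRspace D) [set 0] l -> ell D = l.
Proof.
move=> h; apply: xget_unique => // l' /= h'.
by apply: quot_dim_unique h' h; exact: RRspace_ksubspace.
Qed.

(** A positive [ell D] cannot be the junk value 0, so it is a genuine dimension. *)
Lemma quot_dim_ell D : (0 < ell D)%N -> quot_dim (RRspace D) [set 0] (ell D).
Proof. by rewrite /ell /dimk; case: xgetP => [l -> //|]; rewrite ltnn. Qed.

End Dimension.

(** * Riemann's inequality and pole orders at the rational place *)

Section Riemann.
Variables (k : finFieldType) (F : fieldExtType {fraction {poly k}}).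
Variables (g : nat) (Fgenus : is_genus F g).

Lemma div_deg_seq (D : place F -> int) (r : seq (place F)) :
  uniq r -> (forall Q, Q \notin r -> D Q = 0) ->
  is_divisor D /\ div_deg D = \sum_(Q <- r) D Q * (place_deg Q)%:Z.
Proof.
move=> ur Dr; split.
  apply: (sub_finite_set _ (finite_seq r)) => Q /= DQ.
  by apply: contraNT DQ => /Dr ->.
rewrite /div_deg (fsbigE r) //=.
- by apply: eq_bigl => Q; rewrite in_setT.
- by move=> Q _ /Dr ->; rewrite mul0r.
Qed.

(** The bound on the degree forces [ell D] to be positive, which rules out the junk value. *)
Lemma riemann_inequality (D : place F -> int) : is_divisor D -> g%:Z <= div_deg D ->
  exists2 l : nat, quot_dim (RRspace D) [set 0] l & div_deg D + 1 <= g%:Z + l%:Z.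
Proof.
move=> divD gD; have h := Fgenus.1 _ divD.
exists (ell D); last by lia.
by apply: quot_dim_ell; lia.
Qed.

(** For Q = [Poo] this is the ring R of the overview. *)
Definition regular_off (Q : place F) (f : F) : Prop := forall Q', Q' != Q -> vge Q' 0 f.

Lemma riemann_place (Q : place F) j : (g <= j * place_deg Q)%N ->
  exists2 l : nat, quot_dim [set f | regular_off Q f /\ vge Q (- j%:Z) f]%classic [set 0] l
  & (j * place_deg Q < g + l)%N.
Proof.
move=> gj; pose D (Q' : place F) : int := if Q' == Q then j%:Z else 0.
have DQ0 Q' : Q' \notin [:: Q] -> D Q' = 0 by rewrite inE /D => /negPf ->.
have [divD degD] := @div_deg_seq D [:: Q] isT DQ0.
have degD' : div_deg D = (j * place_deg Q)%N%:Z by rewrite degD big_seq1 /D eqxx.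
case: (riemann_inequality divD) => [|l ql lg]; first by rewrite degD'; lia.
exists l; last by move: lg; rewrite degD'; lia.
suff -> : [set f | regular_off Q f /\ vge Q (- j%:Z) f]%classic = RRspace D by [].
apply/seteqP; split => f /=; rewrite RRspaceP /D.
  by move=> [fr fQ] Q'; case: ifPn => [/eqP ->//|/fr]; rewrite oppr0.
move=> h; split => [Q' Q'Q|]; last by have := h Q; rewrite eqxx.
by have := h Q'; rewrite (negPf Q'Q) oppr0.
Qed.

Variables (s : nat) (Poo : place F) (P : 'I_s -> place F).
Hypotheses (P_inj : injective P) (P_neq_oo : forall i, P i != Poo).

(** The ideal I of the overview. *)
Definition vanishing (d : 'I_s -> nat) (f : F) : Prop :=
  regular_off Poo f /\ forall i, vge (P i) (d i)%:Z f.

(** The space is L(M Poo - sum_i d_i P_i), to which Riemann's inequality applies. *)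
Lemma riemann_vanishing M d :
  (\sum_i d i * place_deg (P i) + g <= M * place_deg Poo)%N ->
  exists2 l : nat, quot_dim [set f | vanishing d f /\ vge Poo (- M%:Z) f]%classic [set 0] l
  & (M * place_deg Poo < g + \sum_i d i * place_deg (P i) + l)%N.
Proof.
move=> gM.
pose D (Q : place F) : int := M%:Z *+ (Q == Poo) - \sum_i (d i)%:Z *+ (Q == P i).
have DPoo : D Poo = M%:Z.
  rewrite /D eqxx big1 ?subr0 // => i _.
  by rewrite eq_sym (negPf (P_neq_oo i)).
have DP i : D (P i) = - (d i)%:Z.
  rewrite /D (negPf (P_neq_oo i)) mulr0n sub0r (bigD1 i) //= eqxx big1 ?addr0 // => j ji.
  by rewrite (inj_eq P_inj) eq_sym (negPf ji).
have DQ Q : Q != Poo -> (forall i, Q != P i) -> D Q = 0.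
  move=> Q1 Q2; rewrite /D (negPf Q1) mulr0n sub0r big1 ?oppr0 // => i _.
  by rewrite (negPf (Q2 i)).
pose r := Poo :: [seq P i | i : 'I_s].
have ur : uniq r.
  rewrite /= map_inj_uniq ?enum_uniq // andbT; apply/negP => /mapP[i _ e].
  by have := P_neq_oo i; rewrite -e eqxx.
have [divD degD] : is_divisor D /\ div_deg D = \sum_(Q <- r) D Q * (place_deg Q)%:Z.
  apply: div_deg_seq ur _ => Q; rewrite inE negb_or => /andP[Q1 Q2].
  apply: DQ => // i; apply: contraNneq Q2 => ->.
  by apply: map_f; rewrite mem_enum.
have degD' : div_deg D =
    (M * place_deg Poo)%N%:Z - (\sum_i d i * place_deg (P i))%N%:Z.
  rewrite degD big_cons DPoo big_image /= PoszM; congr (_ + _).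
  rewrite (big_morph Posz PoszD (erefl _)) -sumrN; apply: eq_bigr => i _.
  by rewrite DP PoszM mulNr.
case: (riemann_inequality divD) => [|l ql lg]; first by rewrite degD'; lia.
exists l; last by move: lg; rewrite degD'; lia.
suff -> : [set f | vanishing d f /\ vge Poo (- M%:Z) f]%classic = RRspace D by [].
apply/seteqP; split => f /=; rewrite RRspaceP.
  move=> [[fr fP] foo] Q.
  have [->|Q1] := eqVneq Q Poo; first by rewrite DPoo.
  have [[i ->]|Q2] := pselect (exists i, Q = P i); first by rewrite DP opprK.
  rewrite DQ ?oppr0 => [||i]; [exact: fr | done | apply/eqP => e].
  by apply: Q2; exists i.
move=> h; have hP i : vge (P i) (d i) f by rewrite -[X in vge _ X]opprK -DP.
split; last by have := h Poo; rewrite DPoo.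
split=> // Q Q1; have [[i ->]|Q2] := pselect (exists i, Q = P i).
  by apply: vge_le (hP i).
rewrite -oppr0 -(DQ Q) // => i; apply/eqP => e.
by apply: Q2; exists i.
Qed.

Lemma regular_off_ksubspace : ksubspace (regular_off Poo).
Proof.
split=> [Q _|c x y hx hy Q Q1]; first exact: vge0.
by apply: vgeD (vgeZ _ (hx _ Q1)) (hy _ Q1); exact: val_ofP.
Qed.

Lemma regular_off1 : regular_off Poo 1.
Proof. by move=> Q _; rewrite -(val1 (val_ofP Q)) vge_val. Qed.

Lemma regular_offM f h : regular_off Poo f -> regular_off Poo h -> regular_off Poo (f * h).
Proof.
move=> hf hh Q Q1; rewrite -[0]addr0; apply: vgeM (hf _ Q1) (hh _ Q1).
exact: val_ofP.
Qed.

Lemma regular_offX f n : regular_off Poo f -> regular_off Poo (f ^+ n).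
Proof.
move=> hf; elim: n => [|n IH]; first by rewrite expr0; exact: regular_off1.
by rewrite exprS; apply: regular_offM.
Qed.

Lemma vge_ksubspace (Q : place F) n : ksubspace (fun f => vge Q n f).
Proof.
split=> [|c x y hx hy]; first exact: vge0.
by apply: vgeD (vgeZ _ hx) hy; exact: val_ofP.
Qed.

Lemma ksubspaceI (V W : set F) : ksubspace V -> ksubspace W ->
  ksubspace (fun f => V f /\ W f).
Proof.
by move=> [V0 hV] [W0 hW]; split=> // c x y [? ?] [? ?]; split; [apply: hV|apply: hW].
Qed.

Lemma vanishing_ksubspace d : ksubspace (vanishing d).
Proof.
apply: ksubspaceI; first exact: regular_off_ksubspace.
split=> [i|c x y hx hy i]; first exact: vge0.
by case: (vge_ksubspace (P i) (d i)) => _; apply.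
Qed.

Lemma vanishingM d f h : regular_off Poo f -> vanishing d h -> vanishing d (f * h).
Proof.
move=> hf [hh hP]; split=> [|i]; first exact: regular_offM.
rewrite -[(d i)%:Z]add0r; apply: vgeM (hf _ (P_neq_oo i)) (hP i).
exact: val_ofP.
Qed.

Hypothesis deg_Poo : place_deg Poo = 1%N.

(** The quotient f / h is a unit at [Poo], where the residue field has dimension 1 over [k]. The
    generator [b] supplied by [quot_dim] need not be 1, so both f / h and 1 are expressed through it
    and their coefficients divided. *)
Lemma deg1_leading_coef f h : f != 0 -> h != 0 -> Poo f = Poo h ->
  exists c, vge Poo (Poo f + 1) (f - constF F c * h).
Proof.
move=> f0 h0 fh; have vP := val_ofP Poo.
have [b [Vb hb]] : quot_dim [set f | vge Poo 0 f]%classic [set f | vge Poo 1 f]%classic 1.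
  by move: deg_Poo; rewrite /place_deg /dimk; case: xgetP => [l -> /= ql <-|].
have [c1 [/= h1 _]] : exists! c : 'rV[k]_1, vge Poo 1 (f / h - \sum_(j < 1) constF F (c 0 j) * b j).
  apply: hb; rewrite /= vgeE ?mulf_neq0 ?invr_neq0 // (valM vP) ?invr_neq0 //.
  by rewrite (valV vP) // fh subrr.
have [c2 [/= h2 _]] : exists! c : 'rV[k]_1, vge Poo 1 (1 - \sum_(j < 1) constF F (c 0 j) * b j).
  by apply: hb; rewrite /= -(val1 vP) vge_val.
move: h1 h2; rewrite !big_ord1 => h1 h2.
have c20 : c2 0 0 != 0.
  apply: contraTneq h2 => ->; rewrite constFE rmorph0 mul0r subr0.
  by rewrite vgeE ?oner_neq0 // (val1 vP).
exists (c1 0 0 / c2 0 0); rewrite fh.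
have -> : f - constF F (c1 0 0 / c2 0 0) * h =
    h * (f / h - constF F (c1 0 0 / c2 0 0)) by rewrite mulrBr mulrCA mulfV // mulr1 [h * _]mulrC.
rewrite (vgeMl vP) //.
rewrite -[f / h](subrK (constF F (c1 0 0) * b ord0)) -addrA; apply: (vgeD vP) => //.
have -> : constF F (c1 0 0) * b ord0 - constF F (c1 0 0 / c2 0 0) =
   constF F (- (c1 0 0 / c2 0 0)) * (1 - constF F (c2 0 0) * b ord0).
  rewrite !constFE mulrBr mulr1 mulrA -rmorphM mulNr divfK // !rmorphN mulNr opprK.
  by rewrite addrC.
exact: vgeZ.
Qed.

(* Otherwise the powers of f would be infinitely many independent elements of a
   finite-dimensional Riemann-Roch space. *)
Lemma regular_vanish f : regular_off Poo f -> vge Poo 1 f -> f = 0.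
Proof.
move=> fr f1; apply/eqP/negPn/negP => f0; have vP := val_ofP Poo.
case: (@riemann_place Poo g) => [|l ql _]; first by rewrite deg_Poo muln1.
have [b [_ sb _]] := quot_dim0P ql.
have VS (c : {ffun 'I_l.+1 -> k}) :
    regular_off Poo (\sum_i constF F (c i) * f ^+ i) /\
    vge Poo (- g%:Z) (\sum_i constF F (c i) * f ^+ i).
  apply: (@ksubspace_sum _ _ (fun f => regular_off Poo f /\ vge Poo (- g%:Z) f)).
    by apply: ksubspaceI; [exact: regular_off_ksubspace | exact: vge_ksubspace].
  move=> i; split; first exact: regular_offX.
  by apply: vge_le (vgeX vP f1 i); rewrite -mulr_natr; lia.
have [h hP] := choice (fun c => sb _ (VS c)).
have injh : injective h.
  move=> c d hcd; apply/ffunP => i.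
  have vf : 0 < Poo f by move: f1; rewrite vgeE.
  have : constF F (c (inord i) - d (inord i)) = 0.
    apply: (@expansion_coef_eq0 _ _ vP f (fun j => constF F (c (inord j) - d (inord j)))
      l.+1) => //.
    - move=> j; set x := _ - _; have [->|x0] := eqVneq x 0; last by right; exact: val_const.
      by left; rewrite constFE rmorph0.
    - have -> : \sum_(j < l.+1) constF F (c (inord j) - d (inord j)) * f ^+ j =
            \sum_i constF F (c i) * f ^+ i - \sum_i constF F (d i) * f ^+ i.
        rewrite -sumrB.
        by apply: eq_bigr => j _; rewrite inord_val !constFE rmorphB mulrBl.
      by rewrite !hP hcd subrr vge0.
  by rewrite inord_val => /eqP; rewrite constFE fmorph_eq0 subr_eq0 => /eqP.
have := leq_card h injh; rewrite !card_ffun !card_ord leq_exp2l ?ltnn //.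
exact: finNzRing_gt1.
Qed.

(** Induction on a bound p for the distance from the order of f to N: a constant multiple of an
    element of W of the same order cancels the leading term. *)
Lemma reduce_pole_order (V W : set F) (N : int) :
  ksubspace V -> ksubspace W -> (W `<=` V)%classic ->
  (forall f, V f -> f != 0 -> Poo f < N -> exists w, [/\ W w, w != 0 & Poo w = Poo f]) ->
  forall f, V f -> exists w, W w /\ vge Poo N (f - w).
Proof.
move=> sV sW WV hW f Vf; have vP := val_ofP Poo.
have [p fp] : exists p : nat, vge Poo (N - p%:Z) f.
  exists `|N - Poo f|%N; apply: vge_le (vge_val Poo f); lia.
elim: p f Vf fp => [|p IH] f Vf fp.
  by exists 0; rewrite subr0; move: fp; rewrite subr0; split=> //; case: sW.
have [fp'|fp'] := boolP (vge Poo (N - p%:Z) f); first exact: IH.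
have fv : Poo f = N - p.+1%:Z.
  by apply: val_eq_vge fp _; apply: contraNN fp'; apply: vge_le; lia.
have f0 : f != 0 by apply: contraNneq fp' => ->; exact: vge0.
have [w [Ww w0 wf]] : exists w, [/\ W w, w != 0 & Poo w = Poo f].
  by apply: hW => //; rewrite fv; lia.
have [c hc] := deg1_leading_coef f0 w0 (esym wf).
have Wc := ksubspaceZ c sW Ww.
case: (IH (f - constF F c * w)).
- by apply: ksubspaceB => //; apply: WV.
- by apply: vge_le hc; rewrite fv; lia.
move=> w' [Ww' h']; exists (constF F c * w + w'); split; first exact: ksubspaceD.
by rewrite opprD addrA.
Qed.

Definition pole_order (V : set F) (n : nat) : Prop :=
  exists f, [/\ V f, f != 0 & Poo f = - n%:Z].

(** Riemann's inequality gives L(M Poo - sum_i d_i P_i) dimension at least M + 1 - g - sum_i d_i deg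
    P_i. One function for each pole order that occurs suffices to span it, so at least that many of
    the M + 1 orders occur. *)
Lemma card_pole_orders d M :
  (\sum_i d i * place_deg (P i) + g <= M)%N ->
  (#|[set n : 'I_M.+1 | ~~ `[< pole_order (vanishing d) n >]]%SET| <=
     g + \sum_i d i * place_deg (P i))%N.
Proof.
move=> dM; case: (@riemann_vanishing M d) => [|l ql]; first by rewrite deg_Poo muln1.
rewrite deg_Poo muln1 => lM.
set V := (X in quot_dim X _ _) in ql.
have sV : ksubspace V.
  by apply: ksubspaceI; [exact: vanishing_ksubspace | exact: vge_ksubspace].
set S := [set n : 'I_M.+1 | `[< pole_order (vanishing d) n >]]%SET.
have exb (n : {n | n \in S}) : exists f, [/\ vanishing d f, f != 0 & Poo f = - (val n : nat)%:Z].
  by case: n => n /=; rewrite inE => /asboolP.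
have [b bP] := choice exb.
have Vb n : V (b n).
  have [h1 h2 h3] := bP n; split=> //; rewrite vgeE // h3.
  by have := ltn_ord (val n); lia.
have sb : spanned V b.
  move=> f Vf.
  pose W : set F := fun f => exists c : {ffun {n | n \in S} -> k},
    f = \sum_i constF F (c i) * b i.
  have sW : ksubspace W.
    split=> [|c x y [cx ->] [cy ->]].
      by exists 0; rewrite big1 // => i _; rewrite ffunE constFE rmorph0 mul0r.
    exists [ffun i => c * cx i + cy i]; rewrite mulr_sumr -big_split /=.
    by apply: eq_bigr => i _; rewrite ffunE !constFE rmorphD rmorphM mulrDl mulrA.
  have WV : (W `<=` V)%classic by move=> _ [c ->]; apply: ksubspace_sum.
  (* With N = 1 the remainder has a zero at [Poo], so [regular_vanish] makes it 0. *)
  have [|w [[c wc] fw]] := @reduce_pole_order V W 1 sV sW WV _ _ Vf.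
    move=> h [Vh hM] h0 h1.
    have hle : Poo h <= 0 by lia.
    move: hM; rewrite vgeE // => hM.
    have hlt : (`|Poo h| < M.+1)%N by lia.
    have hS : Ordinal hlt \in S.
      by rewrite inE; apply/asboolP; exists h; split=> //=; lia.
    pose x0 : {n | n \in S} := exist (fun n => is_true (n \in S)) (Ordinal hlt) hS.
    have [_ b0 bh] := bP x0; exists (b x0); split=> //.
      exists [ffun i => (i == x0)%:R].
      rewrite (bigD1 x0) //= big1 => [|i /negPf ih].
        by rewrite ffunE eqxx constFE rmorph1 mul1r addr0.
      by rewrite ffunE ih constFE rmorph0 mul0r.
    by rewrite bh /=; lia.
  exists c; rewrite -wc; apply/eqP; rewrite -subr_eq0; apply/eqP.
  apply: regular_vanish _ fw; apply: (ksubspaceB regular_off_ksubspace).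
    by case: Vf => -[].
  have [] : V w by apply: WV; exists c.
  by case.
have := quot_dim_le_spanned sV ql sb; rewrite card_sig => lS.
have := cardsC S; rewrite card_ord.
have -> : ~: S = [set n : 'I_M.+1 | ~~ `[< pole_order (vanishing d) n >]]%SET.
  by apply/setP => n; rewrite !inE.
have -> : #|S| = #|[pred n | n \in S]| by apply: eq_card.
lia.
Qed.

End Riemann.

(** * Pole orders of the column functions *)

Section Columns.
Variables (k : finFieldType) (F : fieldExtType {fraction {poly k}}).
Variables (g : nat) (Fgenus : is_genus F g).
Variables (s : nat) (Poo : place F) (P : 'I_s -> place F).
Hypotheses (P_neq_oo : forall i, P i != Poo) (deg_Poo : place_deg Poo = 1%N).

Lemma intmul_fctE (f : place F -> int) (a : int) Q : (f *~ a) Q = f Q *~ a.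
Proof. by case: a => m; rewrite ?NegzE ?mulrNz -?pmulrn ?opprfctE natmulfctE. Qed.

Lemma column_divE l a Q : column_div Poo P l a Q =
  (Q == Poo)%:Z *~ a - \sum_i (Q == P i)%:Z *+
      ((\sum_(i.+1 <= h < s.+1) l h) * (lcm_deg P %/ place_deg (P i)))%N.
Proof.
rewrite /column_div addrfctE opprfctE /= intmul_fctE fct_sumE; congr (_ - _).
by apply: eq_bigr => i _; rewrite natmulfctE.
Qed.

Lemma RRspace_multiple (a : int) f :
  RRspace (prime_div Poo *~ a) f <-> regular_off Poo f /\ vge Poo (- a) f.
Proof.
rewrite RRspaceP; split=> [h|[h hoo] Q].
  split=> [Q /negPf Q1|]; first by have := h Q; rewrite intmul_fctE /prime_div Q1 mul0rz oppr0.
  by have := h Poo; rewrite intmul_fctE /prime_div eqxx intz.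
rewrite intmul_fctE /prime_div; case: eqVneq => [->|Q1]; first by rewrite intz.
by rewrite mul0rz oppr0; apply: h.
Qed.

(* The dimensions are compared inside a large L(j Poo), since Riemann's inequality
   does not exclude the junk value 0 of [ell] for small multiples of Poo. *)
Lemma pole_order_nongap n : pole_order Poo (regular_off Poo) n -> ~ gap_number Poo n.
Proof.
move=> [f [fr f0 fn]] [n0 ge].
case: (@riemann_place _ _ _ Fgenus Poo (maxn n g)) => [|L].
  by rewrite deg_Poo muln1 leq_maxr.
set V := (X in quot_dim X _ _) => qL _.
have qd (m : int) : m <= n%:Z ->
    exists l, quot_dim (RRspace (prime_div Poo *~ m)) [set 0] l.
  move=> mn; apply: quot_dim_sub qL _; first exact: RRspace_ksubspace.
  move=> h /RRspace_multiple[hr hm]; split=> //.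
  by apply: vge_le hm; have := leq_maxl n g; lia.
have [l ql] := qd n%:Z (lexx _).
have [|l' ql'] := qd (n%:Z - 1); first by lia.
have ll' : l = l' by rewrite -(ellE ql) -(ellE ql').
rewrite -ll' in ql'.
have fn' : RRspace (prime_div Poo *~ n%:Z) f.
  by rewrite RRspace_multiple; split=> //; rewrite -fn vge_val.
have sub : (RRspace (prime_div Poo *~ (n%:Z - 1)) `<=` RRspace (prime_div Poo *~ n%:Z))%classic.
  move=> h /RRspace_multiple[hr hm].
  by rewrite RRspace_multiple; split=> //; apply: vge_le hm; lia.
have := quot_dim_subset_eq (@RRspace_ksubspace _ _ _) (@RRspace_ksubspace _ _ _) ql' ql sub fn'.
by rewrite RRspace_multiple => -[_]; rewrite vgeE // fn; lia.
Qed.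

(** Away from [Poo] the column divisor is at most 0 and independent of a, so f is regular there, and
    leaving the second space can only be due to the order at [Poo]. *)
Lemma column_pole_order l (a a' : int) f :
  RRspace (column_div Poo P l a) f -> ~ RRspace (column_div Poo P l a') f ->
  [/\ regular_off Poo f, vge Poo (- a) f & ~~ vge Poo (- a') f].
Proof.
rewrite !RRspaceP => ha ha'.
have Poo_val b : column_div Poo P l b Poo = b.
  rewrite column_divE eqxx intz big1 ?subr0 // => i _.
  by rewrite eq_sym (negPf (P_neq_oo i)) mul0rn.
have off b Q : Q != Poo -> column_div Poo P l b Q = column_div Poo P l 0 Q.
  by move=> /negPf Q1; rewrite !column_divE Q1 !mul0rz.
have neg Q : 0 <= - column_div Poo P l 0 Q.
  by rewrite column_divE mulr0z sub0r opprK sumr_ge0 //.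
split=> [Q Q1||].
- by apply: vge_le (ha Q); rewrite off.
- by have := ha Poo; rewrite Poo_val.
- apply/negP => hoo; apply: ha' => Q; have [->|Q1] := eqVneq Q Poo; first by rewrite Poo_val.
  by rewrite off // -(off a) //; apply: ha.
Qed.

Variables (n : nat -> nat) (n_nongap : nongap_enum Poo n).
Variables (y : nat -> F) (y_choice : refined_columns g Poo P n y).

Lemma nongap_enum_lt r r' : (n r < n r')%N = (r < r')%N.
Proof.
case: n_nongap => hn _; apply/idP/idP; last exact: hn.
apply: contraTT; rewrite -!leqNgt leq_eqVlt => /orP[/eqP ->//|/hn].
exact: ltnW.
Qed.

Lemma pole_order_enum m : pole_order Poo (regular_off Poo) m -> exists r, n r = m.
Proof. by move=> /pole_order_nongap; case: n_nongap => _ /(_ m) -[h _]. Qed.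

(** For r > g the choice of y_r places its pole order above n_(r-1) and at most at n_r. Being a
    nongap, this order is some n_r', and monotonicity leaves only r' = r. *)
Lemma column_pole_enum r : [/\ regular_off Poo (y r), y r != 0 & Poo (y r) = - (n r)%:Z].
Proof.
case: y_choice => ysmall ylarge; have [rg|gr] := leqP r g.
  have [/RRspace_multiple[yr yn] yn'] := ysmall r rg.
  have yn2 : ~~ vge Poo (- (n r)%:Z + 1) (y r).
    apply/negP => h; apply: yn'; apply/RRspace_multiple; split=> //.
    by apply: vge_le h; lia.
  split=> //; last exact: val_eq_vge yn yn2.
  by apply: contraNneq yn2 => ->; rewrite vge0.
have [l [w [_ hy hy']]] := ylarge r gr.
have [yr yn yn'] := column_pole_order hy hy'.
have y0 : y r != 0 by apply: contraNneq yn' => ->; rewrite vge0.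
move: yn yn'; rewrite !vgeE // => yn yn'.
have [|r' nr'] := @pole_order_enum `|Poo (y r)|%N.
  by exists (y r); split=> //; lia.
have rr' : r = r'.
  have h1 : (n r.-1 < n r')%N by rewrite nr'; lia.
  have h2 : (n r' <= n r)%N by rewrite nr'; lia.
  by move: h1 h2; rewrite [(n r' <= _)%N]leqNgt !nongap_enum_lt; lia.
rewrite -rr' in nr'; split=> //; lia.
Qed.

End Columns.

(** * Local expansions and leading coefficients at one place *)

Section LocalField.
Variables (k : finFieldType) (F : fieldExtType {fraction {poly k}}).
Variables (Q : place F) (Fh : completion Q) (K : residue_field Fh).
Local Notation v := (@cval _ _ _ Fh).
Local Notation iota := (cemb Fh).
Let vP : normalized_valuation v := @cvalP _ _ _ Fh.

Lemma vge_emb m f : vge v m (iota f) = vge Q m f.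
Proof. by rewrite /vge fmorph_eq0 cval_emb. Qed.

Lemma residue_exists u : vge v 0 u -> exists a : rfield K, vge v 1 (u - rlift K a).
Proof. by move=> /(rlift_residue K)[a [ha _]]; exists a. Qed.

Lemma rlift_inj_mod (a b : rfield K) :
  vge v 0 (rlift K a) -> vge v 1 (rlift K a - rlift K b) -> a = b.
Proof.
move=> a0 ab; have [r [_ ru]] := rlift_residue K a0.
by rewrite -(ru b ab); apply/esym/ru; rewrite subrr vge0.
Qed.

(** A lift of positive value would reduce to 0 and hence come from 0; applied to the inverse, this
    excludes negative values too. *)
Lemma val_rlift (a : rfield K) : a != 0 -> v (rlift K a) = 0.
Proof.
have ge0 (b : rfield K) : b != 0 -> v (rlift K b) <= 0.
  move=> b0; rewrite leNgt; apply/negP => vb; move/eqP: b0; apply.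
  have lb0 : vge v 1 (rlift K b) by apply: vge_le (vge_val v _); lia.
  apply: rlift_inj_mod; first by apply: vge_le lb0.
  by rewrite rmorph0 subr0.
move=> a0; apply/eqP; rewrite eq_le ge0 //=.
have := ge0 _ (invr_neq0 a0); rewrite fmorphV (valV vP) ?fmorph_eq0 //.
by rewrite oppr_le0.
Qed.

Lemma vge_rlift (a : rfield K) : vge v 0 (rlift K a).
Proof.
have [->|a0] := eqVneq a 0; first by rewrite rmorph0 vge0.
by rewrite -(val_rlift a0) vge_val.
Qed.

Variable (z : F).
Hypothesis z_local_param : Q z = 1.

Let z0 : z != 0.
Proof.
apply/eqP => e; have := z_local_param; rewrite e.
by case: (val_ofP Q) => -> _ _ _.
Qed.

Let iz0 : iota z != 0. Proof. by rewrite fmorph_eq0. Qed.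

Lemma vgeM_param m (h : nat) u : vge v (h%:Z + m) (iota z ^+ h * u) = vge v m u.
Proof.
have -> : h%:Z = v (iota z ^+ h).
  by rewrite (valX vP) // cval_emb z_local_param natz.
by rewrite (vgeMl vP) // expf_neq0.
Qed.

Lemma vge_expansion_term (a : rfield K) (h : nat) : vge v h%:Z (rlift K a * iota z ^+ h).
Proof. by rewrite mulrC -[h%:Z]addr0 vgeM_param vge_rlift. Qed.

Lemma expansion_unique (al be : nat -> rfield K) N :
  vge v N%:Z (\sum_(h < N) rlift K (al h) * iota z ^+ h
           - \sum_(h < N) rlift K (be h) * iota z ^+ h) ->
  forall h, (h < N)%N -> al h = be h.
Proof.
rewrite -sumrB; under eq_bigr => h _ do rewrite -mulrBl -rmorphB.
move=> H h hN; apply/eqP; rewrite -subr_eq0 -(fmorph_eq0 (rlift K)); apply/eqP.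
apply: (@expansion_coef_eq0 _ _ vP (iota z) (fun h => rlift K (al h - be h)) N) => //.
- by rewrite cval_emb z_local_param.
- move=> h'; have [->|x0] := eqVneq (al h' - be h') 0; first by left; rewrite rmorph0.
  by right; exact: val_rlift.
- by rewrite cval_emb z_local_param natz.
Qed.

(** A long enough partial sum approximates y to order N, and its terms of index at least N have
    order at least N themselves. *)
Lemma local_expansion_trunc y (be : nat -> rfield K) N : local_expansion z y be ->
  vge v N%:Z (iota y - \sum_(h < N) rlift K (be h) * iota z ^+ h).
Proof.
move=> /(_ N%:Z)[M hM].
have := hM (M + N)%N (leq_addr _ _).
rewrite [(M + N)%N]addnC big_split_ord /=; set S := \sum_(i < N) _; set T := \sum_(i < M) _ => h.
have -> : iota y - S = - (S + T - iota y) + T by ring.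
apply: (vgeD vP); first by rewrite (vgeN vP).
apply: (vge_sum vP) => i _; apply: vge_le (vge_expansion_term _ _); lia.
Qed.

Variables (g : nat) (Fgenus : is_genus F g).
Hypothesis dimK : \dim {:rfield K} = place_deg Q.

Let polar (j : nat) : set F := [set f | regular_off Q f /\ vge Q (- j%:Z) f]%classic.

(* L(j Q) / L((j - 1) Q) is as large as possible, namely the residue field. *)
Definition saturated (j : nat) : Prop := forall u, vge v (- j%:Z) u ->
  exists f, polar j f /\ vge v (1 - j%:Z) (iota f - u).

(** An upper bound N for dim L(j Q), stated through a spanning family. *)
Let gen j N := exists (I : finType) (b : I -> F), (#|I| <= N)%N /\ spanned (polar j) b.

Let polar_ksubspace j : ksubspace (polar j).
Proof. by apply: ksubspaceI; [exact: regular_off_ksubspace | exact: vge_ksubspace]. Qed.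

(** The leading coefficients at Q of L((j + 1) Q) form a [k]-subspace of the residue field, and
    functions realizing a basis of it span L((j + 1) Q) modulo L(j Q). Without saturation the
    subspace is proper, which saves one dimension. *)
Let gen_step j N : gen j N ->
  exists2 N', gen j.+1 N' & (N' + ~~ `[< saturated j.+1 >] <= N + place_deg Q)%N.
Proof.
move=> [I [b [IN sb]]].
(* Multiplication by z^(j+1) turns the leading coefficient into a residue. *)
pose U (a : rfield K) := exists f, polar j.+1 f /\
  vge v 1 (iota f * iota z ^+ j.+1 - rlift K a).
have [W WP] : exists W : {vspace rfield K}, forall a, U a <-> a \in W.
  apply: subspace_vspace.
    exists 0; rewrite !rmorph0 mul0r subr0 vge0; split=> //.
    by case: (polar_ksubspace j.+1).
  move=> c a a' [f [hf fa]] [f' [hf' fa']]; exists (constF F c * f + f').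
  split; first by case: (polar_ksubspace j.+1) => _; apply.
  rewrite -mulr_algl !(rmorphD, rmorphM) rlift_const /=.
  have -> : (iota (constF F c) * iota f + iota f') * iota z ^+ j.+1 -
     (iota (constF F c) * rlift K a + rlift K a') =
     iota (constF F c) * (iota f * iota z ^+ j.+1 - rlift K a) +
      (iota f' * iota z ^+ j.+1 - rlift K a').
    by rewrite mulrDl mulrBr !mulrA opprD addrACA.
  apply: (vgeD vP) => //; rewrite -[1]add0r; apply: (vgeM vP) => //.
  by rewrite vge_emb; exact: vge_const.
have dW : (\dim W + ~~ `[< saturated j.+1 >] <= place_deg Q)%N.
  rewrite -dimK; case: asboolP => [_|ns] /=; first by rewrite addn0 dimvS ?subvf.
  rewrite addn1 ltn_neqAle dimvS ?subvf // andbT; apply: contra_notN ns.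
  rewrite dimv_leqif_eq ?subvf // => /eqP WT u hu.
  have [a ha] : exists a, vge v 1 (u * iota z ^+ j.+1 - rlift K a).
    apply: residue_exists; rewrite mulrC -[0](addrN (j.+1)%:Z).
    by rewrite vgeM_param.
  have [f [hf fa]] : U a by apply/WP; rewrite WT memvf.
  exists f; split=> //; rewrite -(vgeM_param _ j.+1) addrC subrK.
  by rewrite mulrC mulrBl; apply: (vge_trans vP fa); rewrite (vge_distC vP).
have exf (t : 'I_(\dim W)) : exists f, polar j.+1 f /\
    vge v 1 (iota f * iota z ^+ j.+1 - rlift K (vbasis W)`_t).
  by apply/WP/vbasis_mem/mem_nth; rewrite size_tuple.
have [ft ftP] := choice exf.
exists (#|I| + \dim W)%N; last by rewrite -addnA leq_add.
exists (I + 'I_(\dim W))%type, (fun t => match t with inl i => b i | inr t => ft t end).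
split; first by rewrite card_sum card_ord.
move=> f hf; have [fr fj] := hf.
have [a ha] : exists a, vge v 1 (iota f * iota z ^+ j.+1 - rlift K a).
  apply: residue_exists; rewrite mulrC -[0](addrN (j.+1)%:Z).
  by rewrite vgeM_param vge_emb.
have aW : a \in W by apply/WP; exists f.
(* w has the same leading coefficient as f, so f - w lies in L(j Q). *)
pose w := \sum_t constF F (coord (vbasis W) t a) * ft t.
have hw : polar j.+1 w.
  apply: ksubspace_sum; first exact: polar_ksubspace.
  by move=> t; case: (ftP t).
have wa : vge v 1 (iota w * iota z ^+ j.+1 - rlift K a).
  rewrite (coord_vbasis aW) /w !rmorph_sum /= mulr_suml -sumrB.
  apply: (vge_sum vP) => t _; rewrite -mulr_algl !rmorphM rlift_const /= -mulrA -mulrBr.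
  rewrite -[1]add0r; apply: (vgeM vP); first by rewrite vge_emb; exact: vge_const.
  by case: (ftP t).
have hfw : polar j (f - w).
  have [h1 h2] := ksubspaceB (polar_ksubspace j.+1) hf hw; split=> //.
  rewrite -vge_emb -(vgeM_param _ j.+1) rmorphB mulrC mulrBl.
  have -> : (j.+1)%:Z - j%:Z = 1 by lia.
  by apply: (vge_trans vP ha); rewrite (vge_distC vP).
have [c fc] := sb _ hfw.
exists [ffun t => match t with inl i => c i | inr t => coord (vbasis W) t a end].
rewrite big_sumType /= -[f](subrK w) fc; congr (_ + _).
  by apply: eq_bigr => i _; rewrite ffunE.
by apply: eq_bigr => i _; rewrite ffunE.
Qed.

(* Each j that is not saturated costs at least one dimension out of the
   j * deg Q + 1 - g guaranteed by Riemann's inequality. *)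
Lemma eventually_saturated : exists j0 : nat, forall j, (j0 <= j)%N -> saturated j.
Proof.
have e0 : (0 < place_deg Q)%N by rewrite -dimK; exact: adim_gt0.
case: (@riemann_place _ _ _ Fgenus Q g) => [|l0 ql0 _]; first by rewrite leq_pmulr.
have [b0 [_ sb0 _]] := quot_dim0P ql0.
(* The number of unsaturated orders among 1, ..., j. *)
pose ns j := (\sum_(i < j) ~~ `[< saturated i.+1 >])%N.
have ns_bound j : exists2 N, gen j N & (N + ns j <= l0 + j * place_deg Q)%N.
  elim: j => [|j [N gN hN]].
    exists l0; last by rewrite /ns big_ord0 mul0n !addn0.
    exists 'I_l0, b0; rewrite card_ord; split=> // f [fr f0].
    by apply: sb0; split=> //; apply: vge_le f0; lia.
  have [N' gN' hN'] := gen_step gN; exists N' => //.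
  by rewrite /ns big_ord_recr /= -/(ns j) mulSn; lia.
have ns_mono i j : (i <= j)%N -> (ns i <= ns j)%N.
  by move=> /subnK <-; rewrite addnC /ns big_split_ord leq_addr.
(* Passing to j + g makes Riemann's inequality applicable, since deg Q is positive. *)
have ns_le j : (ns j <= l0 + g)%N.
  apply: leq_trans (ns_mono _ _ (leq_addr g j)) _; set j' := (j + g)%N.
  case: (@riemann_place _ _ _ Fgenus Q j') => [|l ql lj].
    by rewrite (leq_trans (leq_addl j g)) // leq_pmulr.
  have [N [I [b [IN sb]]] hN] := ns_bound j'.
  have := quot_dim_le_spanned (polar_ksubspace j') ql sb; lia.
apply: contrapT => unsat.
have ns_unbound t : exists j, (t <= ns j)%N.
  elim: t => [|t [j tj]]; first by exists 0%N.
  have [j' jj' nj'] : exists2 j', (j <= j')%N & ~ saturated j'.+1.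
    apply: contrapT => h; apply: unsat; exists j.+1 => -[|j'] //.
    by rewrite ltnS => jj'; apply: contrapT => hs; apply: h; exists j'.
  exists j'.+1; rewrite /ns big_ord_recr /= -/(ns j') asboolF // addn1 ltnS.
  exact: leq_trans tj (ns_mono _ _ jj').
have [j] := ns_unbound (l0 + g).+1.
by rewrite ltnNge ns_le.
Qed.

End LocalField.

(** * Strong approximation and surjectivity of the generating rows *)

Section StrongApproximation.
Variables (k : finFieldType) (F : fieldExtType {fraction {poly k}}).
Variables (g : nat) (Fgenus : is_genus F g).
Variables (s : nat) (Poo : place F) (P : 'I_s -> place F).
Hypotheses (P_inj : injective P) (P_neq_oo : forall i, P i != Poo).
Hypothesis deg_Poo : place_deg Poo = 1%N.
Variables (z : 'I_s -> F) (z_local_param : forall i, P i (z i) = 1).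
Variables (Fh : forall i, completion (P i)) (K : forall i, residue_field (Fh i)).
Hypothesis dimK : forall i, \dim {:rfield (K i)} = place_deg (P i).
Local Notation v i := (@cval _ _ _ (Fh i)).
Local Notation iota i := (cemb (Fh i)).

Lemma vanishing_neq0 d : exists2 f, vanishing Poo P d f & f != 0.
Proof.
set M := (\sum_i d i * place_deg (P i) + g)%N.
case: (@riemann_vanishing _ _ _ Fgenus _ _ _ P_inj P_neq_oo M d) => [|l ql lM].
  by rewrite deg_Poo muln1.
case: (quot_dim_gt0 _ ql) => [||f [hf _] f0]; last by exists f.
  by apply: ksubspaceI; [exact: vanishing_ksubspace | exact: vge_ksubspace].
by move: lM; rewrite deg_Poo /M; lia.
Qed.

Lemma monomial_approximation i (D h : nat) (a : rfield (K i)) :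
  exists x, [/\ regular_off Poo x,
     vge (v i) (h%:Z + 1) (iota i x - rlift (K i) a * iota i (z i) ^+ h)
   & forall j, j != i -> vge (P j) D%:Z x].
Proof.
have [j0 sat] := eventually_saturated (z_local_param i) Fgenus (dimK i).
have [w [wr wP] w0] := vanishing_neq0 (fun=> 1%N).
have vw j : 1 <= P j w by have := wP j; rewrite vgeE.
have viP := @cvalP _ _ _ (Fh i).
have iw0 : iota i w != 0 by rewrite fmorph_eq0.
(* With c the order of w at P_i, the factor w^l turns a pole of order j = l c - h into a zero of
   order h. This l ensures j >= j0, so that j is saturated, and order at least D at the other
   places. *)
pose l := (D + h + j0)%N.
pose c := `|P i w|%N.
have hc : P i w = c%:Z by have := vw i; rewrite /c; lia.
have c1 : (0 < c)%N by have := vw i; lia.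
have vwl : v i (iota i w ^+ l) = (l * c)%N%:Z.
  by rewrite (valX viP) // cval_emb hc mulnC PoszM -mulr_natr natz.
have llc : (l <= l * c)%N by rewrite leq_pmulr.
pose j := (l * c - h)%N.
have j0j : (j0 <= j)%N by rewrite /j /l in llc *; lia.
have hu : vge (v i) (- j%:Z) (iota i w ^- l * (rlift (K i) a * iota i (z i) ^+ h)).
  have -> : - j%:Z = v i (iota i w ^- l) + h%:Z.
    by rewrite (valV viP) ?expf_neq0 // vwl /j; rewrite /l in llc *; lia.
  by rewrite (vgeMl viP) ?invr_neq0 ?expf_neq0 // vge_expansion_term.
have [f [[fr fj] hf]] := sat j j0j _ hu.
have regl Q n : Q != Poo -> vge Q n f -> vge Q n (f * w ^+ l).
  move=> Q1 hQ; rewrite -[n]addr0; apply: (vgeM (val_ofP Q)) => //.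
  exact: (regular_offX _ wr).
exists (f * w ^+ l); split.
- move=> Q Q1; have [->|Q2] := eqVneq Q (P i); last by apply: regl => //; apply: fr.
  rewrite mulrC; apply: (@vge_le _ _ (P i (w ^+ l) - j%:Z)).
    by rewrite (valX (val_ofP (P i))) // hc -mulr_natr natz /j; lia.
  by rewrite (vgeMl (val_ofP (P i))) // expf_neq0.
- have -> : iota i (f * w ^+ l) - rlift (K i) a * iota i (z i) ^+ h =
      iota i w ^+ l * (iota i f - iota i w ^- l * (rlift (K i) a * iota i (z i) ^+ h)).
    by rewrite rmorphM rmorphXn mulrBr mulVKf ?expf_neq0 // [in RHS]mulrC.
  apply: (@vge_le _ _ (v i (iota i w ^+ l) + (1 - j%:Z))).
    by rewrite vwl /j; rewrite /l in llc *; lia.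
  by rewrite (vgeMl viP) // expf_neq0.
- move=> j' j'i; rewrite -[D%:Z]add0r; apply: (vgeM (val_ofP (P j'))).
    by apply: fr; rewrite (inj_eq P_inj).
  apply: vge_le (vgeX (val_ofP (P j')) (wP j') l).
  by rewrite -mulr_natr natz /l; lia.
Qed.

(** One coefficient at a time: the current error has order at least N, and a monomial approximation
    with its coefficient b at z^N corrects it. *)
Lemma place_approximation i (D N : nat) (a : nat -> rfield (K i)) :
  exists x, [/\ regular_off Poo x,
     vge (v i) N%:Z (iota i x - \sum_(h < N) rlift (K i) (a h) * iota i (z i) ^+ h)
   & forall j, j != i -> vge (P j) D%:Z x].
Proof.
have viP := @cvalP _ _ _ (Fh i).
elim: N => [|N [x [xr xi xj]]].
  exists 0; split=> [Q _||j _]; rewrite ?vge0 //.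
  by rewrite big_ord0 (rmorph0 (iota i)) subrr; exact: vge0.
set r := iota i x - _ in xi.
pose t := rlift (K i) (a N) * iota i (z i) ^+ N - r.
have ht : vge (v i) N%:Z t by apply: (vgeB viP) => //; apply: vge_expansion_term.
have zi0 : iota i (z i) != 0.
  rewrite fmorph_eq0; apply/eqP => e; have := z_local_param i; rewrite e.
  by case: (val_ofP (P i)) => -> _ _ _.
have [b hb] : exists b, vge (v i) 1 (iota i (z i) ^- N * t - rlift (K i) b).
  apply: residue_exists; rewrite -(vgeM_param (z_local_param i) _ N) addr0.
  by rewrite mulVKf ?expf_neq0.
have [x' [xr' xi' xj']] := monomial_approximation D N b.
exists (x + x'); split.
- exact: ksubspaceD (regular_off_ksubspace _) xr xr'.
- rewrite big_ord_recr /= rmorphD.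
  have -> : (N.+1)%:Z = N%:Z + 1 by lia.
  have -> : iota i x + iota i x' - (\sum_(h < N) rlift (K i) (a h) * iota i (z i) ^+ h +
       rlift (K i) (a N) * iota i (z i) ^+ N) =
    (iota i x' - rlift (K i) b * iota i (z i) ^+ N) -
     iota i (z i) ^+ N * (iota i (z i) ^- N * t - rlift (K i) b).
    rewrite mulrBr mulVKf ?expf_neq0 // [iota i (z i) ^+ N * _]mulrC opprB addrA subrK.
    by rewrite /t /r opprB opprD !addrA [iota i x + _]addrC.
  by apply: (vgeB viP) => //; rewrite (vgeM_param (z_local_param i)).
- by move=> j ji; apply: (vgeD (val_ofP (P j))); [apply: xj|apply: xj'].
Qed.

(** The approximations at the single places are added; each vanishes at the other places to order D
    >= d_i and does not disturb them. *)
Lemma strong_approximation (d : 'I_s -> nat) (a : forall i, nat -> rfield (K i)) :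
  exists x, regular_off Poo x /\ forall i,
   vge (v i) (d i)%:Z (iota i x - \sum_(h < d i) rlift (K i) (a i h) * iota i (z i) ^+ h).
Proof.
pose D := (\max_i d i)%N.
have [x xP] := choice (fun i => place_approximation D (d i) (a i)).
exists (\sum_i x i); split.
  move=> Q Q1; apply: (vge_sum (val_ofP Q)) => i _.
  by case: (xP i) => /(_ Q Q1).
move=> i; rewrite rmorph_sum (bigD1 i) //= addrAC.
apply: (vgeD (@cvalP _ _ _ (Fh i))); first by case: (xP i).
apply: (vge_sum (@cvalP _ _ _ (Fh i))) => j ji; rewrite vge_emb.
case: (xP j) => _ _ /(_ i); rewrite eq_sym ji => /(_ isT).
by apply: vge_le; rewrite lez_nat /D leq_bigmax.
Qed.

Variables (n : nat -> nat) (n_nongap : nongap_enum Poo n).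
Variables (y : nat -> F) (y_choice : refined_columns g Poo P n y).

Lemma pole_order_vanishing d m N :
  (g + \sum_i d i * place_deg (P i) <= m)%N -> (0 < m)%N -> (n m.-1 < N)%N ->
  pole_order Poo (regular_off Poo) N -> pole_order Poo (vanishing Poo P d) N.
Proof.
move=> dm m0 nN [x [xr x0 xN]]; apply: contrapT => notN.
have yP := column_pole_enum Fgenus P_neq_oo deg_Poo n_nongap y_choice.
have nr (r : 'I_m) : (n r < N)%N.
  apply: leq_ltn_trans nN; have [rm|] := ltnP r m.-1.
    by rewrite ltnW // (nongap_enum_lt n_nongap).
  by move=> h; have -> : (r = m.-1 :> nat) by have := ltn_ord r; lia.
(* A function in I of pole order 0, multiplied by x, would have pole order N. *)
have not0 : ~ pole_order Poo (vanishing Poo P d) 0.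
  move=> [f [hf f0 fv]]; apply: notN; exists (x * f); split.
  - exact: vanishingM.
  - by rewrite mulf_neq0.
  - by rewrite (valM (val_ofP Poo)) // xN fv oppr0 addr0.
(* Here the multiplier that would produce pole order N is y_r. *)
have notr (r : 'I_m) : ~ pole_order Poo (vanishing Poo P d) (N - n r).
  have [yr y0 yv] := yP r.
  move=> [f [hf f0 fv]]; apply: notN; exists (y r * f); split.
  - exact: vanishingM.
  - by rewrite mulf_neq0.
  - by rewrite (valM (val_ofP Poo)) // yv fv; have := nr r; lia.
pose M := (N + m)%N.
have := @card_pole_orders _ _ _ Fgenus _ _ _ P_inj P_neq_oo deg_Poo d M.
rewrite addnC => /(_ (leq_trans dm (leq_addl _ _))).
set S := [set _ | _]%SET => cS.
(* The missing orders N - n_r, together with 0 for [None], are m + 1 distinct numbers, more than the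
   bound g + sum_i d_i deg P_i allows. *)
pose c (r : option 'I_m) : 'I_M.+1 := if r is Some r then inord (N - n r) else inord 0.
have cE r : c r = (if r is Some r then N - n r else 0)%N :> nat.
  by case: r => [r|]; rewrite inordK // /M; lia.
have injc : injective c.
  move=> r r' /(congr1 val) /=; rewrite !cE; case: r r' => [r|] [r'|] //.
  - move=> h; congr Some; apply/val_inj => /=.
    have e : n r = n r' by have := nr r; have := nr r'; lia.
    case: (ltngtP r r') => //; rewrite -(nongap_enum_lt n_nongap) e; lia.
  - by have := nr r; lia.
  - by have := nr r'; lia.
have cS' : [set c r | r : option 'I_m]%SET \subset S.
  apply/fintype.subsetP => _ /imsetP[r _ ->]; rewrite inE asboolF // cE.
  by case: r => [r|]; [exact: notr | exact: not0].
have := leq_trans (subset_leq_card cS') cS.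
rewrite card_imset // card_option card_ord; lia.
Qed.

Lemma columns_surjective d m (a : forall i, nat -> rfield (K i)) :
  (g + \sum_i d i * place_deg (P i) <= m)%N -> (0 < m)%N ->
  exists c : {ffun 'I_m -> k}, forall i, vge (v i) (d i)%:Z
    (iota i (\sum_r constF F (c r) * y r)
      - \sum_(h < d i) rlift (K i) (a i h) * iota i (z i) ^+ h).
Proof.
move=> dm m0; have [x [xr xa]] := strong_approximation d a.
have yP := column_pole_enum Fgenus P_neq_oo deg_Poo n_nongap y_choice.
have rK := regular_off_ksubspace Poo.
(* Subtracting an element u of I lowers the pole order to at most n_(m-1) and keeps the prescribed
   coefficients. *)
have [u [[ur uP] hu]] : exists u, vanishing Poo P d u /\ vge Poo (- (n m.-1)%:Z) (x - u).
  apply: (@reduce_pole_order _ _ _ deg_Poo (regular_off Poo)) => //.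
  - exact: vanishing_ksubspace.
  - by move=> u [].
  move=> f fr f0 fn.
  have [] : pole_order Poo (vanishing Poo P d) `|Poo f|%N.
    apply: pole_order_vanishing dm m0 _ _; first by lia.
    by exists f; split=> //; lia.
  by move=> w [hw w0 wv]; exists w; split=> //; rewrite wv; lia.
pose W : set F := fun f => exists c : {ffun 'I_m -> k}, f = \sum_i constF F (c i) * y i.
pose V : set F := fun f => regular_off Poo f /\ vge Poo (- (n m.-1)%:Z) f.
have sV : ksubspace V by apply: ksubspaceI => //; exact: vge_ksubspace.
have sW : ksubspace W.
  split=> [|c f h [cf ->] [ch ->]].
    by exists 0; rewrite big1 // => i _; rewrite ffunE constFE rmorph0 mul0r.
  exists [ffun i => c * cf i + ch i]; rewrite mulr_sumr -big_split /=.
  by apply: eq_bigr => i _; rewrite ffunE !constFE rmorphD rmorphM mulrDl mulrA.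
have WV : (W `<=` V)%classic.
  move=> _ [c ->]; apply: ksubspace_sum => // r.
  have [yr y0 yv] := yP r; split=> //; rewrite vgeE // yv lerN2 lez_nat.
  by rewrite leqNgt (nongap_enum_lt n_nongap); have := ltn_ord r; lia.
have Vxu : V (x - u) by split=> //; apply: (ksubspaceB rK).
(* Every pole order still possible is that of some y_r with r < m, so their span absorbs x - u. *)
have [w [[c wc] hw]] : exists w, W w /\ vge Poo 1 (x - u - w).
  apply: (reduce_pole_order deg_Poo sV sW WV _ Vxu).
  move=> f [fr fn] f0 f1.
  have [r nr] : exists r, n r = `|Poo f|%N.
    apply: (pole_order_enum Fgenus deg_Poo n_nongap).
    by exists f; split=> //; lia.
  have rm : (r < m)%N.
    suff : (r <= m.-1)%N by lia.
    rewrite leqNgt -(nongap_enum_lt n_nongap) -leqNgt nr.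
    by move: fn; rewrite vgeE //; lia.
  have [_ y0 yv] := yP r; exists (y r); split=> //; last by rewrite yv nr; lia.
  exists [ffun i => (i == Ordinal rm)%:R].
  rewrite (bigD1 (Ordinal rm)) //= big1 => [|i /negPf ih].
    by rewrite ffunE eqxx constFE rmorph1 mul1r addr0.
  by rewrite ffunE ih constFE rmorph0 mul0r.
have xw : x = u + w.
  apply/eqP; rewrite addrC -subr_eq -subr_eq0; apply/eqP.
  apply: (regular_vanish Fgenus deg_Poo) hw; apply: (ksubspaceB rK); first by case: Vxu.
  by have [] : V w by apply: WV; exists c.
exists c => i; rewrite -wc.
have -> : w = x - u by rewrite xw addrC addKr.
rewrite rmorphB addrAC; apply: (vgeB (@cvalP _ _ _ (Fh i))); first exact: xa.
by rewrite vge_emb.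
Qed.

Variables (beta : forall i, nat -> nat -> rfield (K i)).
Hypothesis beta_expansion : forall i r, local_expansion (z i) (y r) (fun h => beta i h r).
Variables (B : forall i, (place_deg (P i)).-tuple (rfield (K i))).
Hypothesis B_basis : forall i, basis_of fullv (B i).
Variables (C : 'I_s -> nat -> nat -> k).
Hypothesis C_columns : generating_matrices B beta C.

Lemma rows_surjective (d D : 'I_s -> nat) m (t : 'I_s -> nat -> k) :
  (forall i, d i <= D i * place_deg (P i))%N ->
  (g + \sum_i D i * place_deg (P i) <= m)%N -> (0 < m)%N ->
  exists c : {ffun 'I_m -> k}, forall i j,
     (1 <= j <= d i)%N -> \sum_(r < m) C i j r * c r = t i j.
Proof.
move=> dD Dm m0.
(* The target values of the rows in block h, read as coordinates of one expansion coefficient. *)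
pose a i h : rfield (K i) :=
  \sum_(u < place_deg (P i)) t i (h * place_deg (P i) + u.+1)%N *: (B i)`_u.
have [c hc] := columns_surjective a Dm m0; exists c => i j /andP[j1 jd].
have viP := @cvalP _ _ _ (Fh i).
pose e := place_deg (P i).
have e0 : (0 < e)%N by rewrite /e -dimK; exact: adim_gt0.
(* Rows are numbered from 1, so j - 1 is divided by e to find the block and the position in it. *)
pose h := (j.-1 %/ e)%N; have ue : (j.-1 %% e < e)%N by rewrite ltn_pmod.
pose u := Ordinal ue.
have je : j = (h * e + u.+1)%N by rewrite /h /= addnS -divn_eq prednK.
have hD : (h < D i)%N by rewrite /h ltn_divLR // prednK // (leq_trans jd).
(* The expansion coefficients of sum_r c_r y_r; uniqueness of expansions identifies them with
   [a i]. *)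
pose ga (h : nat) : rfield (K i) := \sum_r c r *: beta i h r.
have gaE (h' : nat) : rlift (K i) (ga h') =
    \sum_r iota i (constF F (c r)) * rlift (K i) (beta i h' r).
  rewrite rmorph_sum; apply: eq_bigr => r _ /=.
  by rewrite -mulr_algl rmorphM rlift_const.
have ga_trunc : vge (v i) (D i)%:Z (iota i (\sum_r constF F (c r) * y r)
    - \sum_(h < D i) rlift (K i) (ga h) * iota i (z i) ^+ h).
  have -> : iota i (\sum_r constF F (c r) * y r)
      - \sum_(h < D i) rlift (K i) (ga h) * iota i (z i) ^+ h =
      \sum_r iota i (constF F (c r)) * (iota i (y r) -
         \sum_(h < D i) rlift (K i) (beta i h r) * iota i (z i) ^+ h).
    rewrite rmorph_sum; under eq_bigr => r _ do rewrite rmorphM /=.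
    under [X in _ - X]eq_bigr => h' _ do rewrite gaE mulr_suml.
    rewrite exchange_big /= -sumrB; apply: eq_bigr => r _.
    rewrite mulrBr mulr_sumr; congr (_ - _); apply: eq_bigr => h' _.
    by rewrite mulrA.
  apply: (vge_sum viP) => r _; rewrite -[(D i)%:Z]add0r; apply: (vgeM viP).
    by rewrite vge_emb; exact: vge_const.
  exact: local_expansion_trunc (z_local_param i) _ _ _ (beta_expansion i r).
have ag : ga h = a i h.
  apply: (expansion_unique (z_local_param i)) hD.
  apply: (vge_trans viP) (hc i); rewrite (vge_distC viP).
  exact: ga_trunc.
rewrite {1}je; under eq_bigr => r _ do rewrite C_columns mulrC.
transitivity (coord (B i) u (ga h)).
  by rewrite linear_sum; apply: eq_bigr => r _; rewrite linearZ.
by rewrite ag /a coord_sum_free ?(basis_free (B_basis i)) // je.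
Qed.

End StrongApproximation.

(** * Digit expansions and elementary intervals *)

Section Digits.
Variables (R : realType) (b : nat).
Implicit Types (a : nat -> 'I_b).

(** The numerator of the m-digit truncation over b^m, with [a 1] as its leading digit. *)
Fixpoint digit_nat a m : nat := if m is m'.+1 then (digit_nat a m' * b + a m)%N else 0%N.

Lemma digit_sumE a m : (0 < b)%N -> digit_sum R a m = (digit_nat a m)%:R / b%:R ^+ m.
Proof.
move=> b0; rewrite /digit_sum; elim: m => [|m IH]; first by rewrite big_geq // mul0r.
have bR : (b%:R : R) != 0 by rewrite pnatr_eq0 -lt0n.
rewrite big_nat_recr //= IH natrD natrM exprSr invfM mulrDl; congr (_ + _).
by rewrite mulrACA divff // mulr1.
Qed.

Lemma digit_nat_bounds a d p :
  (digit_nat a d * b ^ p <= digit_nat a (d + p) < (digit_nat a d).+1 * b ^ p)%N.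
Proof.
elim: p => [|p /andP[IH1 IH2]]; first by rewrite addn0 expn0 !muln1 !leqnn.
rewrite addnS /= expnSr !mulnA; have ab := ltn_ord (a (d + p).+1).
apply/andP; split; first by rewrite (leq_trans _ (leq_addr _ _)) // leq_mul2r IH1 orbT.
have : ((digit_nat a (d + p)).+1 * b <= (digit_nat a d).+1 * b ^ p * b)%N.
  by rewrite leq_mul2r IH2 orbT.
by rewrite mulSn; lia.
Qed.

Lemma digit_nat_lt a d : (digit_nat a d < b ^ d)%N.
Proof. by have /andP[_] := digit_nat_bounds a 0 d; rewrite mul1n add0n. Qed.

(** After scaling by b^m, the interval and the range of integers with given d leading digits both
    start at a multiple of b^(m-d) and have that length, so they coincide or are disjoint. *)
Lemma mem_elem_interval a d m A : (d <= m)%N ->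
  ((A%:R / b%:R ^+ d <= digit_sum R a m < A.+1%:R / b%:R ^+ d) =
   (digit_nat a d == A))%R.
Proof.
move=> dm; have b0 : (0 < b)%N by case: b a => [a|//]; case: (a 0%N).
have bR p : 0 < (b%:R : R) ^+ p by rewrite exprn_gt0 // ltr0n.
rewrite digit_sumE //; move: dm => /subnKC <-; set p := (m - d)%N.
have div_d (B : nat) : B%:R / b%:R ^+ d = (B * b ^ p)%N%:R / b%:R ^+ (d + p) :> R.
  by rewrite exprD natrM natrX invfM mulrACA divff ?mulr1 // gt_eqF.
rewrite !div_d ler_pM2r ?invr_gt0 // ltr_pM2r ?invr_gt0 // ler_nat ltr_nat.
have bp0 : (0 < b ^ p)%N by rewrite expn_gt0 b0.
have /andP[h1 h2] := digit_nat_bounds a d p.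
apply/idP/eqP => [/andP[h3 h4]|<-]; last by rewrite h1.
apply/eqP; rewrite eqn_leq -ltnS -(ltn_pmul2r bp0) (leq_ltn_trans h1 h4) /=.
by rewrite -ltnS -(ltn_pmul2r bp0) (leq_ltn_trans h3 h2).
Qed.

Lemma digit_nat_inj a a' d : digit_nat a d = digit_nat a' d <->
  forall j, (1 <= j <= d)%N -> a j = a' j.
Proof.
elim: d => [|d IH] /=; first by split=> // _ [].
split=> [h j /andP[j1 jd]|h].
  have e : (digit_nat a d * b + a d.+1 == digit_nat a' d * b + a' d.+1)%N by rewrite h.
  have ad := ltn_ord (a d.+1); have ad' := ltn_ord (a' d.+1).
  have b0 : (0 < b)%N by lia.
  have h1 : digit_nat a d = digit_nat a' d.
    by have := congr1 (divn^~ b) (eqP e); rewrite !divnMDl // !divn_small // !addn0.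
  have [jd'|] := leqP j d; first by apply: IH.1; rewrite ?j1.
  move=> dj; have -> : j = d.+1 by lia.
  by apply/val_inj => /=; move: e; rewrite h1 eqn_add2l => /eqP.
congr (_ * b + _)%N; last by rewrite h ?leqnn.
by apply/IH => j /andP[j1 jd]; apply: h; rewrite j1 ltnW.
Qed.

Lemma digit_nat_surj d A : (A < b ^ d)%N -> (0 < b)%N -> exists a, digit_nat a d = A.
Proof.
move=> + b0; elim: d A => [|d IH] A Ad.
  by exists (fun=> Ordinal b0); move: Ad; rewrite expn0 ltnS leqn0 => /eqP.
have [|a aA] := IH (A %/ b)%N; first by rewrite ltn_divLR // -expnSr.
exists (fun j => if j == d.+1 then Ordinal (ltn_pmod A b0) else a j) => /=.
rewrite eqxx /= [RHS](divn_eq A b); congr (_ * b + _)%N; rewrite -aA.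
by apply/digit_nat_inj => j /andP[_ jd]; rewrite ltn_eqF.
Qed.

Lemma digit_sum_ge0 a m : (0 < b)%N -> 0 <= digit_sum R a m.
Proof. by move=> b0; rewrite digit_sumE // divr_ge0 // exprn_ge0. Qed.

Lemma digit_sum_lt1 a m : (0 < b)%N -> digit_sum R a m < 1.
Proof.
move=> b0; rewrite digit_sumE // ltr_pdivrMr ?exprn_gt0 ?ltr0n // mul1r.
by rewrite -natrX ltr_nat digit_nat_lt.
Qed.

Lemma digit_sum_cvg a : (0 < b)%N ->
  (digit_sum R a @ \oo --> digit_value R a)%classic.
Proof.
move=> b0; apply: nondecreasing_is_cvgn.
  apply/nondecreasing_seqP => m; rewrite /digit_sum [leRHS]big_nat_recr //= lerDl.
  by rewrite divr_ge0 // exprn_ge0.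
exists 1 => _ [m _ <-]; exact: ltW (digit_sum_lt1 _ _ b0).
Qed.

Lemma digit_value_itv a : (0 < b)%N -> 0 <= digit_value R a <= 1.
Proof.
move=> b0; have cv := @digit_sum_cvg a b0; apply/andP; split.
  by apply: (limr_ge cv); apply: nearW => m; exact: digit_sum_ge0.
by apply: (limr_le cv); apply: nearW => m; apply: ltW; exact: digit_sum_lt1.
Qed.

Lemma base_expansion_inj m n n' : (n < b ^ m)%N -> (n' < b ^ m)%N ->
  (forall r, (r < m)%N -> n %/ b ^ r = n' %/ b ^ r %[mod b]) -> n = n'.
Proof.
elim: m n n' => [|m IH] n n'; first by rewrite expn0 !ltnS !leqn0 => /eqP -> /eqP ->.
rewrite expnSr => hn hn' h.
have b0 : (0 < b)%N by case: (b) hn => //; rewrite muln0.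
rewrite (divn_eq n b) (divn_eq n' b).
have := h 0%N (ltn0Sn m); rewrite expn0 !divn1 => ->; congr (_ * b + _)%N.
apply: IH; rewrite ?ltn_divLR // => r rm.
by rewrite -!divnMA -!expnS; apply: h.
Qed.

Lemma elem_volE s (d : 'I_s -> nat) : elem_vol R b d = (b%:R ^+ (\sum_i d i)%N)^-1.
Proof. by rewrite /elem_vol prodfV expr_sum. Qed.

End Digits.

(** The fibers of a surjective linear map are translates of its kernel, so they partition the domain
    into parts of equal size. *)
Lemma card_linear_fiber (k : finFieldType) (I J : finType) (M : J -> I -> k) :
  (forall x : J -> k, exists c : {ffun I -> k}, forall j, \sum_i M j i * c i = x j) ->
  forall x : J -> k,
  (#|[set c : {ffun I -> k} | [forall j, (\sum_i M j i * c i == x j)%R]]%SET| * #|k| ^ #|J|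
   = #|k| ^ #|I|)%N.
Proof.
move=> surj x.
pose phi (c : {ffun I -> k}) : {ffun J -> k} := [ffun j => \sum_i M j i * c i].
have fiberE (u : {ffun J -> k}) (c : {ffun I -> k}) :
    (phi c == u) = [forall j, \sum_i M j i * c i == u j].
  apply/eqP/forallP => [<- j|h]; first by rewrite ffunE.
  by apply/ffunP => j; rewrite ffunE; apply/eqP.
have phiD c d : phi (c + d) = phi c + phi d.
  apply/ffunP => j; rewrite !ffunE -big_split /=; apply: eq_bigr => i _.
  by rewrite ffunE mulrDr.
pose fib u := [set c | phi c == u]%SET.
have fib_card u : #|fib u| = #|fib 0|.
  have [c hc] := surj u.
  have phic : phi c = u by apply/ffunP => j; rewrite ffunE hc.
  rewrite -(card_imset (fib 0) (addrI c)); apply: eq_card => w; rewrite inE.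
  apply/eqP/imsetP => [hw|[w' + ->]]; last by rewrite inE phiD phic => /eqP ->; rewrite addr0.
  exists (w - c); last by rewrite addrC subrK.
  by rewrite inE; apply/eqP/(addIr (phi c)); rewrite -phiD subrK add0r phic.
have -> : [set c : {ffun I -> k} | [forall j, \sum_i M j i * c i == x j]]%SET = fib (finfun x).
  apply/setP => c; rewrite !inE fiberE; apply: eq_forallb => j; by rewrite ffunE.
rewrite fib_card -!card_ffun.
rewrite -[RHS]sum1_card (partition_big phi xpredT) //= [RHS](eq_bigr (fun=> #|fib 0|)).
  by rewrite sum_nat_const mulnC.
by move=> u _; rewrite -(fib_card u) -sum1dep_card.
Qed.

(** * Counting the points of the digital method *)

Section DigitalMethod.
Variables (R : realType) (k : finFieldType) (s : nat) (C : 'I_s -> nat -> nat -> k).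
Variables (psi : nat -> 'I_#|k| -> k) (psi_bij : forall r, bijective (psi r)).
Hypothesis psi_0 : exists r0, forall r, (r0 <= r)%N -> psi r (digit0 k) = 0.
Variables (lam : 'I_s -> nat -> k -> 'I_#|k|).
Hypothesis lam_bij : forall i j, (1 <= j)%N -> bijective (lam i j).
Local Notation q := #|k|.

Let q1 : (1 < q)%N. Proof. exact: finNzRing_gt1. Qed.
Let q0 : (0 < q)%N. Proof. exact: ltnW. Qed.

(** Indices of one block share all digits from position m on, which contribute a shift t independent
    of n. *)
Lemma digital_y_block m h : exists t : 'I_s -> nat -> k, forall (n : 'I_(q ^ m)) i j,
  digital_y C psi (h * q ^ m + n) i j =
    \sum_(r < m) C i j r * psi r (base_digit k n r) + t i j.
Proof.
have [r0 psi0] := psi_0.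
(* From position N on, every index of the block has digit 0 and [psi] sends it to 0. *)
pose N := (r0 + h.+1 * q ^ m)%N.
exists (fun i j => \sum_(r < N)
  C i j (m + r)%N * psi (m + r)%N (base_digit k (h * q ^ m) (m + r)%N)).
move=> n i j; have hn := ltn_ord n.
have low r : (r < m)%N -> base_digit k (h * q ^ m + n) r = base_digit k n r.
  move=> rm; apply/val_inj => /=.
  have -> : (h * q ^ m = q ^ r * (h * q ^ (m - r)))%N.
    by rewrite mulnCA -expnD subnKC // ltnW.
  rewrite [(q ^ r * _)%N]mulnC.
  rewrite divnMDl ?expn_gt0 ?q0 // -modnDml.
  suff -> : (h * q ^ (m - r) %% q = 0)%N by rewrite add0n.
  by apply/eqP; rewrite -[_ == _]/(q %| _)%N dvdn_mull // dvdn_exp // subn_gt0.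
have high r : base_digit k (h * q ^ m + n) (m + r) = base_digit k (h * q ^ m) (m + r).
  apply/val_inj => /=; rewrite expnD !divnMA divnMDl ?expn_gt0 ?q0 //.
  by rewrite (divn_small hn) addn0 mulnK // expn_gt0 q0.
rewrite /digital_y (fsbigE (iota 0 (m + N))) ?iota_uniq //=; last first.
  move=> r _; rewrite mem_iota /= add0n -leqNgt => rN.
  have -> : base_digit k (h * q ^ m + n) r = digit0 k.
    apply/val_inj => /=; rewrite divn_small ?mod0n //.
    apply: (@leq_ltn_trans r); last exact: ltn_expl.
    apply: leq_trans rN; apply: (@leq_trans (h * q ^ m + q ^ m)%N).
      by rewrite leq_add2l ltnW.
    by rewrite [(h * _ + _)%N]addnC -mulSn /N addnA leq_addl.
  rewrite psi0 ?mulr0 //; apply: leq_trans rN.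
  by rewrite /N addnCA leq_addr.
rewrite (eq_bigl xpredT) => [|r]; last by rewrite in_setT.
have -> : iota 0 (m + N) = index_iota 0 (m + N) by rewrite /index_iota subn0.
rewrite big_mkord big_split_ord /=; congr (_ + _); apply: eq_bigr => r _.
  by rewrite low.
by rewrite high.
Qed.

Definition digit_vector m (n : 'I_(q ^ m)) : {ffun 'I_m -> k} :=
  [ffun r : 'I_m => psi r (base_digit k n r)].

Lemma digit_vector_bij m : bijective (@digit_vector m).
Proof.
apply: inj_card_bij; last by rewrite card_ffun !card_ord.
move=> n n' e; apply/val_inj; apply: (@base_expansion_inj q m) => [||r rm]; rewrite ?ltn_ord //.
have := congr1 (fun u : {ffun 'I_m -> k} => u (Ordinal rm)) e; rewrite !ffunE /=.
by move=> /(bij_inj (psi_bij r)) /(congr1 val).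
Qed.

Local Notation a := (digital_digits C psi lam).

(** As the maps [lam] are bijective, membership in the interval fixes the values of the first d_i
    rows for each i: an affine system in the digit vector of n, whose solutions are counted by
    [card_linear_fiber]. *)
Lemma digital_count m h (d A : 'I_s -> nat) :
  (forall t : 'I_s -> nat -> k, exists c : {ffun 'I_m -> k}, forall i j,
     (1 <= j <= d i)%N -> \sum_(r < m) C i j r * c r = t i j) ->
  (forall i, d i <= m)%N -> (forall i, A i < q ^ d i)%N ->
  (count_in (@elem_interval R q s d A) (@truncated_block R q s a h m)
    * q ^ (\sum_i d i) = q ^ m)%N.
Proof.
move=> surj dm Ad; have [t tP] := digital_y_block m h.
have [de deP] := choice (fun i => digit_nat_surj (Ad i) q0).
(* Only rows j >= 1 have a bijective [lam]; 0 is a default at j = 0. *)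
have exS i j : exists x, (1 <= j)%N -> lam i j x = de i j.
  by case: (leqP 1 j) => [j1|]; [have [f _ fK] := lam_bij i j1; exists (f (de i j)) | exists 0].
have [si siP] := choice (fun ij : 'I_s * nat => exS ij.1 ij.2).
pose J : finType := {i : 'I_s & 'I_(d i)}.
pose M (jj : J) (r : 'I_m) := C (tag jj) (tagged jj).+1 r.
pose x (jj : J) := si (tag jj, (tagged jj).+1) - t (tag jj) (tagged jj).+1.
have surjM (u : J -> k) : exists c : {ffun 'I_m -> k}, forall jj, \sum_r M jj r * c r = u jj.
  pose t' i j := if insub j.-1 : option 'I_(d i) is Some j' then u (Tagged _ j') else 0.
  have [c cP] := surj t'; exists c => -[i j] /=.
  rewrite /M /= cP ?ltn_ord // /t' /=; case: insubP => [j' _ e|]; last by rewrite ltn_ord.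
  by congr (u (Tagged _ _)); apply/val_inj.
have cardJ : #|J| = (\sum_i d i)%N.
  rewrite card_tagged sumnE big_map big_enum /=.
  by apply: eq_bigr => i _; rewrite card_ord.
have := card_linear_fiber surjM x; rewrite cardJ card_ord; apply: etrans; congr (_ * _)%N.
have key (n : 'I_(q ^ m)) : @elem_interval R q s d A (@truncated_block R q s a h m n) <->
    forall jj, \sum_r M jj r * digit_vector n r = x jj.
  have yE i j : digital_y C psi (h * q ^ m + n) i j =
      \sum_(r < m) C i j r * digit_vector n r + t i j.
    by rewrite tP; congr (_ + _); apply: eq_bigr => r _; rewrite ffunE.
  have siE i j c : (1 <= j)%N -> lam i j c = de i j <-> c = si (i, j).
    move=> j1; have e := siP (i, j) j1; rewrite /= in e; rewrite -e.
    by split=> [/(bij_inj (lam_bij i j1))|->].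
  split=> [hn [i j]|hn i].
    have := hn i; rewrite /truncated_block mem_elem_interval // -deP => /eqP.
    move=> /digit_nat_inj/(_ j.+1); rewrite ltn_ord => /(_ isT).
    rewrite /digital_digits siE // yE => e.
    by rewrite /x /= -e addrK.
  rewrite /truncated_block mem_elem_interval // -deP; apply/eqP/digit_nat_inj => j /andP[j1 jd].
  rewrite /digital_digits siE // yE.
  case: j j1 jd => // j _ jd; have := hn (Tagged _ (Ordinal jd)).
  by rewrite /M /x /= => ->; rewrite subrK.
rewrite /count_in -(card_imset _ (bij_inj (@digit_vector_bij m))).
apply: eq_card => c; have [dv dvK Kdv] := @digit_vector_bij m.
rewrite -[c]Kdv (mem_imset _ _ (bij_inj (@digit_vector_bij m))) !inE.
apply/asboolP/forallP => [/key hn jj|hn]; first by rewrite hn.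
by apply/key => jj; apply/eqP.
Qed.

End DigitalMethod.

(** * From row surjectivity to the two parameters *)

Theorem mainTheorem3
  (R : realType)
  (k : finFieldType) (F : fieldExtType {fraction {poly k}})
  (Fconst : full_constant_field F)
  (g : nat) (Fgenus : is_genus F g)
  (s : nat) (s_gt0 : (0 < s)%N)
  (Poo : place F) (P : 'I_s -> place F)
  (P_inj : injective P) (P_neq_oo : forall i, P i != Poo)
  (deg_Poo : place_deg Poo = 1%N)
  (* the columns *)
  (n : nat -> nat) (n_nongap : nongap_enum Poo n)
  (y : nat -> F) (y_choice : refined_columns g Poo P n y)
  (z : 'I_s -> F) (z_local_param : forall i, P i (z i) = 1)
  (Fh : forall i, completion (P i)) (K : forall i, residue_field (Fh i))
  (beta : forall i, nat -> nat -> rfield (K i))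
  (beta_expansion : forall i r,
     local_expansion (z i) (y r) (fun h => beta i h r))
  (B : forall i, (place_deg (P i)).-tuple (rfield (K i)))
  (B_basis : forall i, basis_of fullv (B i))
  (C : 'I_s -> nat -> nat -> k) (C_columns : generating_matrices B beta C)
  (* the digital method *)
  (psi : nat -> 'I_#|k| -> k) (psi_bij : forall r, bijective (psi r))
  (psi_0 : exists r0, forall r, (r0 <= r)%N -> psi r (digit0 k) = 0)
  (lam : 'I_s -> nat -> k -> 'I_#|k|)
  (lam_bij : forall i j, (1 <= j)%N -> bijective (lam i j)) :
  let e := fun i => place_deg (P i) in
  let a := digital_digits C psi lam in
  let x := fun m i => digit_value R (a m i) in
  ue_sequence g e x a /\
  t_sequence (g + \sum_(i < s) (e i - 1))%N x a.
Proof.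
move=> e a x.
have q1 : (1 < #|k|)%N by exact: finNzRing_gt1.
have q0 : (0 < #|k|)%N by exact: ltnW.
have qR : 1 < (#|k|%:R : R) by rewrite ltr1n.
have qR0 : (#|k|%:R : R) != 0 by rewrite gt_eqF // (lt_trans ltr01).
have dimK i : \dim {:rfield (K i)} = place_deg (P i).
  exact: size_basis (B_basis i).
have e0 i : (0 < e i)%N by rewrite /e -dimK; exact: adim_gt0.
have xa : has_expansions x a.
  by move=> m i; split; [exact: digit_value_itv | exact: digit_sum_cvg].
have cube m h : in_unit_cube (@truncated_block R #|k| s a h m).
  by move=> j i; rewrite digit_sum_ge0 // digit_sum_lt1.
have volE (d : 'I_s -> nat) : elem_vol R #|k| d = #|k|%:R ^ (- (\sum_i d i)%N%:Z).
  by rewrite elem_volE exprnN.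
have surj d D m : (forall i, d i <= D i * e i)%N -> (g + \sum_i D i * e i <= m)%N -> (0 < m)%N ->
    forall t : 'I_s -> nat -> k, exists c : {ffun 'I_m -> k}, forall i j,
     (1 <= j <= d i)%N -> \sum_(r < m) C i j r * c r = t i j.
  move=> dD Dm m0 t.
  exact: (rows_surjective Fgenus P_inj P_neq_oo deg_Poo z_local_param dimK n_nongap
    y_choice beta_expansion B_basis C_columns).
have dleq (d : 'I_s -> nat) i m : (\sum_i d i <= m)%N -> (d i <= m)%N.
  by apply: leq_trans; rewrite (bigD1 i) //= leq_addr.
split; split=> // h m gm; split=> // d A Ad.
  move=> ed; rewrite volE ler_eXz2l // => dm.
  have dm' : (g + \sum_i d i <= m)%N by lia.
  (* Since e_i divides d_i, the first d_i rows are exactly d_i / e_i full blocks. *)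
  have cnt := digital_count R psi_bij psi_0 lam_bij h
    (surj d (fun i => d i %/ e i)%N m _ _ _) _ Ad.
  have qd0 : (#|k|%:R : R) ^+ (\sum_i d i)%N != 0 by rewrite expf_neq0.
  apply: (mulIf qd0); rewrite -mulrA -exprnN mulVf // mulr1 -!natrX -natrM cnt //.
  - by move=> i; rewrite divnK.
  - by rewrite (eq_bigr d) // => i _; rewrite divnK.
  - by lia.
  - by move=> i; apply: dleq; lia.
rewrite volE => vd.
have dm : (\sum_i d i + (g + \sum_(i < s) (e i - 1)) = m)%N.
  suff : - (\sum_i d i)%N%:Z = (g + \sum_(i < s) (e i - 1))%N%:Z - m%:Z by lia.
  by apply/eqP; rewrite eq_le -!(ler_eXz2l qR) vd lexx.
(* Rounding d_i up to full blocks costs at most e_i - 1 rows, which is the extra term of t. *)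
pose D i := ((d i + (e i - 1)) %/ e i)%N.
have cnt := digital_count R psi_bij psi_0 lam_bij h (surj d D m _ _ _) _ Ad.
apply/eqP; rewrite -(@eqn_pmul2r (#|k| ^ \sum_i d i)) ?expn_gt0 ?q0 // cnt.
- by rewrite -expnD addnC dm.
- by move=> i; have := ltn_ceil (d i + (e i - 1))%N (e0 i); rewrite /D mulSn; lia.
- rewrite -dm addnCA leq_add2l -big_split /=; apply: leq_sum => i _.
  exact: leq_trunc_div.
- by lia.
- by move=> i; apply: dleq; lia.
Qed.
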